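(* Let $\mu$ be a log-concave probability measure on $\mathbb{R}$, symmetric with respect to the origin, with density $f$ that is positive on an open interval $(a_f,b_f)$ and zero outside it. In each of the following cases, the given set has $\mu$-measure $r$ and asymmetry $\lambda$, and it has the lowest $\mu$-perimeter among all measurable subsets of $\mathbb{R}$ with $\mu$-measure $r$ and asymmetry $\lambda$: (1) $\big(F^{-1}(\tfrac{\lambda}{2}),\ F^{-1}(r+\tfrac{\lambda}{2})\big)$, when $0<r\le 1/2$ and $r<\lambda\le\min(2r,1-r)$; (2) $\big(-\infty,\ F^{-1}(r-\tfrac{\lambda}{2})\big)\cup\big(F^{-1}(1-\tfrac{\lambda}{2}),\ +\infty\big)$, when $0<\lambda\le r$ and $r\le 1/2$; (3) $\big(F^{-1}(1-r-\tfrac{\lambda}{2}),\ F^{-1}(1-\tfrac{\lambda}{2})\big)$, when $0<\lambda\le 1-r$ and $1/2\le r<1$; (4) $\big(-\infty,\ F^{-1}(\tfrac{\lambda}{2})\big)\cup\big(F^{-1}(1-r+\tfrac{\lambda}{2}),\ +\infty\big)$, when $1/2\le r<1$ and $1-r<\lambda\le\min(2(1-r),r)$.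
   Context: Measure: $f$ is the density of $\mu$ with respect to Lebesgue measure $\mathcal{L}^1$; $a_f,b_f$ may be infinite; log-concave means $f=e^{-V}$ on $(a_f,b_f)$ with $V$ convex; symmetric means $f(-x)=f(x)$. $F$ is the cumulative distribution function of $\mu$, an increasing bijection from $(a_f,b_f)$ to $(0,1)$ with inverse $F^{-1}$; convention $F^{-1}(0)=-\infty$, $F^{-1}(1)=+\infty$. Perimeter: for measurable $\Omega\subset\mathbb{R}$ and $d\in[0,1]$, $\Omega^d$ is the set of $x\in\mathbb{R}$ such that $\lim_{\rho\to0}\mathcal{L}^1(\Omega\cap B_\rho(x))/\mathcal{L}^1(B_\rho(x))=d$, where $B_\rho(x)=(x-\rho,x+\rho)$. The essential boundary is $\partial^M\Omega=\mathbb{R}\setminus(\Omega^0\cup\Omega^1)$, and the $\mu$-perimeter is $P_\mu(\Omega)=\int_{\partial^M\Omega}f\,d\mathcal{H}^0=\sum_{x\in\partial^M\Omega}f(x)\in[0,+\infty]$ ($\mathcal{H}^0$ is counting measure). Asymmetry of a measurable set $\Omega$: $\lambda_\mu(\Omega)=\min\{\mu(\Omega\,\Delta\,(-\infty,\sigma_-)),\ \mu(\Omega\,\Delta\,(\sigma_+,+\infty))\}$, where $\sigma_-=F^{-1}(\mu(\Omega))$, $\sigma_+=F^{-1}(1-\mu(\Omega))$ and $\Delta$ is symmetric difference. *)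

(* Defs.v *)
From mathcomp Require Import all_boot all_order all_algebra.
From mathcomp Require Import all_classical all_reals all_analysis.

Set Implicit Arguments.
Unset Strict Implicit.
Unset Printing Implicit Defensive.

Import Order.TTheory GRing.Theory Num.Theory.
Import numFieldNormedType.Exports.

Local Open Scope classical_set_scope.
Local Open Scope ring_scope.

(** The real line with the sigma-algebra of all Lebesgue measurable sets, i.e.
    the domain of [completed_lebesgue_measure] (and not merely the Borel sets,
    for which the type is [measurableTypeR R]). *)
Notation lebesgueTypeR R := (caratheodory_type (@wlength R idfun)^*%mu).

Section Definitions.
Context {R : realType}.

(** Open interval of reals with possibly infinite end points. *)
Definition eitv (u v : \bar R) : set R := EFin @^-1` `]u, v[%classic.

Section LogConcaveDensity.
Variables (mu : probability (lebesgueTypeR R) R) (f : R -> R) (a b : \bar R).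

Definition is_density : Prop :=
  forall A : set (lebesgueTypeR R), measurable A ->
    mu A = (\int[completed_lebesgue_measure]_(x in A) (f x)%:E)%E.

Definition log_concave : Prop :=
  exists2 V : R -> R, convex_function (eitv a b) V &
    forall x, x \in eitv a b -> f x = expR (- V x).

Definition cdfR (x : R) : R := fine (mu `]-oo, x]%classic).

(** Inverse of [cdfR] seen as a bijection from the interval ]a, b[ to ]0, 1[,
    extended by -oo at 0 and +oo at 1; not meaningful outside of [0, 1]. *)
Definition cdfR_inv (p : R) : \bar R :=
  if p == 0 then -oo%E else if p == 1 then +oo%E
  else ('pinv_(fun=> 0) (eitv a b) cdfR p)%:E.

Definition asymmetry (A : set R) : \bar R :=
  let m := fine (mu A) in
  Order.min (mu (A `+` eitv -oo%E (cdfR_inv m)))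
            (mu (A `+` eitv (cdfR_inv (1 - m)) +oo%E)).

Definition density_points (A : set R) (d : R) : set R :=
  [set x | (completed_lebesgue_measure (A `&` ball x rho)
            * (completed_lebesgue_measure (ball x rho))^-1)%E
           @[rho --> 0^'+] --> d%:E].

Definition ess_boundary (A : set R) : set R :=
  ~` (density_points A 0 `|` density_points A 1).

Definition perimeter (A : set R) : \bar R :=
  \esum_(x in ess_boundary A) (f x)%:E.

Definition admissible (r lam : R) (A : set (lebesgueTypeR R)) : Prop :=
  [/\ measurable A, mu A = r%:E & asymmetry A = lam%:E].

Definition perimeter_minimizer (r lam : R) (A : set (lebesgueTypeR R)) : Prop :=
  admissible r lam A /\
  forall B, admissible r lam B -> (perimeter A <= perimeter B)%E.

End LogConcaveDensity.
End Definitions.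

(* Main.v *)
Require Import Defs.
From mathcomp Require Import all_boot all_order all_algebra.
From mathcomp Require Import all_classical all_reals all_analysis.
From mathcomp Require Import measurable_realfun lra ring.
Import Order.TTheory GRing.Theory Num.Theory.
Import numFieldNormedType.Exports.
Local Open Scope classical_set_scope.
Local Open Scope ring_scope.
Set Implicit Arguments.
Unset Strict Implicit.
Unset Printing Implicit Defensive.

(** The distribution function [F] turns [mu] into the Lebesgue measure of
    ]0, 1[ and the weight [f] into [I p = f (F^-1 p)].  All that survives of
    log-concavity and symmetry is that [I], extended by 0 at 0 and 1, is concave
    and symmetric about 1/2 ([isoprofile_iso]): if [c] is a supergradient of
    [ln f] at [y], then [f u <= f y + c * (F u - F y)] for all [u]
    ([density_supergradient]), so the line of slope [c] through [(F y, f y)]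
    lies above the graph of [I].

    A set [E] of finite perimeter enters only through the mass [G p] that it
    has below the quantile [p] and through the set [S] of the images by [F] of
    its essential boundary points; the perimeter is the sum of [I] over [S].
    Between consecutive points of [S] the set [E] is null or full: when [E]
    fills a fraction of an interval strictly between 0 and 1, some interior
    point has neither density 0 nor density 1 ([ess_boundary_between]).
    Moreover [S] has no accumulation point inside ]0, 1[, because [I] has a
    positive lower bound on each compact subinterval ([crossings_isolated]).  These facts form the
    record [mass_profile], and the asymmetry of [E] is the minimum of
    [2 * (r - G r)] and [2 * G (1 - r)], where [r = G 1].

    Replacing [E] by its complement turns [G p] into [p - G p] and exchanges [r]
    and [1 - r], while [S] and the asymmetry stay the same.  Hence the cases
    [1/2 <= r] follow from the cases [r <= 1/2].  By reflection one may also
    assume that the asymmetry is [2 * (r - s)] with [s = G r], so that [E] has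
    mass [s] below [r] and mass [r - s] above it.  The crossings closest to [r]
    on either side are then located by counting masses.

    If [r <= 2 * s], the nearest crossing on the left and the nearest on the
    right of [r] already cost [I s + I (r - s)] ([tails_bound]).  If
    [2 * s < r], the target is [I (r - s) + I (2 * r - s)].  By subadditivity of
    [I], the mass of [E] that comes after its first component reaching above [r]
    may be moved next to that component without raising the cost
    ([right_end_cost]).  When [E] is full just below [r], the component then ends
    at [2 * r - s] and starts at a point of cost at least [I (r - s)].  When [E]
    is null there, the component becomes [(p, p + (r - s))] with [r <= p], and
    comes with a crossing of cost at least [I s] below [r]; the total is concave
    in [p], so that only the two extreme positions matter ([iso_shift]). *)

(** * Concave symmetric profiles on the unit interval *)

Section IsoProfile.
Context {R : realType}.
Variable I : R -> R.

(** Concavity is stated for three ordered points with the denominators cleared,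
    so that degenerate triples are allowed. *)
Record iso_profile : Prop := IsoProfile {
  iso0 : I 0 = 0;
  iso_sym : forall x, I (1 - x) = I x;
  iso_concave : forall x y z, 0 <= x -> x <= y -> y <= z -> z <= 1 ->
    (z - y) * I x + (y - x) * I z <= (z - x) * I y }.

Hypothesis HI : iso_profile.

Lemma iso_ge0 x : 0 <= x -> x <= 1 -> 0 <= I x.
Proof.
move=> x0 x1; have := iso_concave HI (lexx 0) x0 x1 (lexx 1).
have := iso_sym HI 0; rewrite (iso0 HI) subr0 => ->; lra.
Qed.

Lemma iso_subadd x y : 0 <= x -> 0 <= y -> x + y <= 1 -> I (x + y) <= I x + I y.
Proof.
move=> x0 y0 xy1; have [xy|xy] := leP (x + y) 0.
  have -> : x = 0 by lra.
  have -> : y = 0 by lra.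
  rewrite addr0 (iso0 HI); lra.
have hx := iso_concave HI (lexx 0) x0 (_ : x <= x + y) xy1.
have hy := iso_concave HI (lexx 0) y0 (_ : y <= x + y) xy1.
rewrite -(ler_pM2l xy); move: hx hy; rewrite (iso0 HI) => hx hy.
have {}hx := hx ltac:(lra); have {}hy := hy ltac:(lra); nra.
Qed.

(** A point is deeper than [x] when it lies between [x] and the mirror image
    [1 - x], and [I] takes the same value at these two ends. *)
Lemma iso_deeper x y : 0 <= x -> x <= y -> y <= 1 - x -> I x <= I y.
Proof.
move=> x0 xy y1; have [x2|x2] := leP (1 - x - x) 0.
  by have -> : x = y by lra.
have := iso_concave HI x0 xy y1; rewrite (iso_sym HI) => /(_ ltac:(lra)) h.
rewrite -(ler_pM2l x2); nra.
Qed.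

(** The cost of an interval of fixed mass [g] is concave in its position, hence
    is at least what it is at one of the two extreme positions. *)
Lemma iso_translate g T p0 p p1 :
  0 <= p0 -> p0 <= p -> p <= p1 -> 0 <= g -> p1 + g <= 1 ->
  T <= I p0 + I (p0 + g) -> T <= I p1 + I (p1 + g) -> T <= I p + I (p + g).
Proof.
move=> p00 p0p pp1 g0 p1g h0 h1.
have [pp|pp] := leP p1 p0; first by have -> : p = p0 by lra.
have /= a := iso_concave HI p00 p0p pp1 ltac:(lra).
have /= b := @iso_concave HI (p0 + g) (p + g) (p1 + g)
  ltac:(lra) ltac:(lra) ltac:(lra) p1g.
have d : 0 < p1 - p0 by lra.
rewrite -(ler_pM2l d); nra.
Qed.

(** An interval of mass [r - s] starting at [p], together with a crossing of
    cost [I s] on its left.  At the leftmost position [p = r] the bound follows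
    from monotonicity; at the rightmost one, the interval is the mirror image of
    [(r - s, 2 * r - 2 * s)], and merging its far end with the mass [s] gives
    [I s + I (2 * r - 2 * s) >= I (2 * r - s)]. *)
Lemma iso_shift r s p : 0 <= s -> s + s < r -> 3 * r <= 1 + 2 * s ->
  r <= p -> p <= 1 - 2 * r + 2 * s ->
  I (r - s) + I (2 * r - s) <= I s + (I p + I (p + (r - s))).
Proof.
move=> s0 sr r3 rp pr.
rewrite -lerBlDl; apply: (@iso_translate _ _ r p (1 - 2 * r + 2 * s)).
all: try lra.
  have := @iso_deeper (r - s) r ltac:(lra) ltac:(lra) ltac:(lra).
  have := @iso_ge0 s ltac:(lra) ltac:(lra).
  by rewrite (_ : r + (r - s) = 2 * r - s); lra.
have := @iso_subadd s (2 * r - 2 * s) ltac:(lra) ltac:(lra) ltac:(lra).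
rewrite (_ : s + _ = 2 * r - s); last by lra.
rewrite (_ : 1 - 2 * r + 2 * s + _ = 1 - (r - s)); last by lra.
rewrite (_ : 1 - 2 * r + 2 * s = 1 - (2 * r - 2 * s)); last by lra.
by rewrite !(iso_sym HI); lra.
Qed.
End IsoProfile.

(** * Sets seen through their mass functions *)

Section MassProfile.
Context {R : realType}.
Implicit Types (G : R -> R) (S : set R).

(** [G p] stands for the mass that a set has in ]0, p[ and [S] for its essential
    boundary.  The set is null on ]x, y[ when [G y = G x] and full there when
    [G y - G x = y - x]; [mass_pure] is the only link between [G] and [S]. *)
Record mass_profile G S : Prop := MassProfile {
  mass0 : G 0 = 0;
  mass_mono : forall x y, 0 <= x -> x <= y -> y <= 1 -> G x <= G y;
  mass_lip : forall x y, 0 <= x -> x <= y -> y <= 1 -> G y - G x <= y - x;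
  mass_pure : forall x y, 0 < x -> x < y -> y < 1 ->
    (forall z, S z -> x < z -> z < y -> False) ->
    G y = G x \/ G y - G x = y - x;
  mass_isolated : forall x, 0 < x -> x < 1 ->
    exists2 e : R, 0 < e & forall y, S y -> y <> x -> e <= `|y - x| }.

(** The complement has the same essential boundary. *)
Lemma mass_profile_compl G S :
  mass_profile G S -> mass_profile (fun x => x - G x) S.
Proof.
move=> H; split.
- by rewrite (mass0 H) subr0.
- by move=> x y x0 xy y1; have := mass_lip H x0 xy y1; lra.
- by move=> x y x0 xy y1; have := mass_mono H x0 xy y1; lra.
- by move=> x y x0 xy y1 /(mass_pure H x0 xy y1) []; lra.
- exact: mass_isolated H.
Qed.

Lemma mass_profile_refl G S :
  mass_profile G S -> mass_profile (fun x => G 1 - G (1 - x)) [set x | S (1 - x)].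
Proof.
move=> H; split.
- by rewrite subr0 subrr.
- by move=> x y x0 xy y1;
    have := mass_mono H (_ : 0 <= 1 - y) (_ : 1 - y <= 1 - x); lra.
- by move=> x y x0 xy y1;
    have := mass_lip H (_ : 0 <= 1 - y) (_ : 1 - y <= 1 - x); lra.
- move=> x y x0 xy y1 h.
  have [|||||] := @mass_pure _ _ H (1 - y) (1 - x); try lra.
  by move=> z Sz *; apply: (h (1 - z)) => /=; rewrite ?subKr//; lra.
- move=> x x0 x1; have [||e e0 he] := @mass_isolated _ _ H (1 - x); try lra.
  exists e => // y /he /= h yx; have /h : 1 - y <> 1 - x by move=> E; apply: yx; lra.
  by rewrite (_ : 1 - y - (1 - x) = - (y - x)) ?normrN//; lra.
Qed.

(** Since [S] has no accumulation point at [p], the set is null or full on each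
    side of [p], and on both sides in the same way unless [p] is in [S]. *)
Lemma local_pure G S (p : R) : mass_profile G S -> 0 < p -> p < 1 ->
  exists e : R, [/\ 0 < e, e < p & e < 1 - p] /\
   [/\ G p = G (p - e) \/ G p - G (p - e) = e,
       G (p + e) = G p \/ G (p + e) - G p = e &
       S p \/ (G (p + e) = G (p - e) \/ G (p + e) - G (p - e) = e + e)].
Proof.
move=> H p0 p1; have [d d0 hd] := mass_isolated H p0 p1.
pose m := Num.min p (1 - p); pose e := Num.min d m / 2.
have [m0 mp m1] : [/\ 0 < m, m <= p & m <= 1 - p].
  by rewrite /m; case: (ltP p (1 - p)) => *; split; lra.
have [e0 ed ep e1] : [/\ 0 < e, e < d, e < p & e < 1 - p].
  by rewrite /e; case: (ltP d m) => *; split; lra.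
have iso y : S y -> y <> p -> p - e < y -> y < p + e -> False.
  by move=> Sy yp *; have := hd y Sy yp; case: ler0P => *; lra.
exists e; split=> //; split.
- have [|||||] := @mass_pure _ _ H (p - e) p; [lra..| |by left|by right; lra].
  by move=> z Sz z1 z2; apply: (iso z) => //; [move=> ?|]; lra.
- have [|||||] := @mass_pure _ _ H p (p + e); [lra..| |by left|by right; lra].
  by move=> z Sz z1 z2; apply: (iso z) => //; [move=> ?|]; lra.
- have [Sp|Sp] := pselect (S p); [by left|right].
  have [|||||] := @mass_pure _ _ H (p - e) (p + e); [lra..| |by left|by right; lra].
  by move=> z Sz z1 z2; apply: (iso z) => // zp; apply: Sp; rewrite -zp.
Qed.

(** The tool that produces crossings: a null stretch which does not reach 1 has a
    right end [w], which belongs to [S], and the set is full just after [w].  The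
    three lemmas that follow are its images under complement and reflection. *)
Lemma null_until G S p0 p1 : mass_profile G S ->
  0 <= p0 -> p0 < p1 -> p1 < 1 -> G p0 = G p1 -> G p1 < G 1 ->
  exists w, [/\ S w, p1 <= w < 1, G w = G p1 &
    exists2 e : R, 0 < e < 1 - w & G (w + e) - G w = e].
Proof.
move=> H p00 p01 p11 Gp Gp1.
pose A := [set x | p1 <= x <= 1 /\ G x = G p1].
have Ap1 : A p1 by split=> //; rewrite lexx; lra.
have ubA : ubound A 1 by move=> x [/andP[]].
have supA : has_sup A by split; [exists p1 | exists 1].
have wp1 : p1 <= sup A by apply: (sup_ubound (proj2 supA)).
have w1 : sup A <= 1 by apply: ge_sup => //; exists p1.
set w := sup A in wp1 w1.
have Gw : G w = G p1.
  have h1 := mass_mono H (_ : 0 <= p1) wp1 w1.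
  apply/eqP; rewrite eq_le h1 ?andbT; last by lra.
  rewrite leNgt; apply/negP => h2.
  have [x [/andP[xp1 x1] Gx] wx] := @sup_adherent _ A (G w - G p1) ltac:(lra) supA.
  have xw : x <= w by apply: (sup_ubound (proj2 supA)); split=> //; apply/andP.
  have := mass_lip H (_ : 0 <= x) xw w1; rewrite -/w in wx; lra.
have {}w1 : w < 1.
  rewrite lt_neqAle w1 andbT; apply/eqP => ww; move: Gw; rewrite ww; lra.
have notA x : w < x -> x <= 1 -> G x <> G p1.
  move=> wx x1 Gx; have : x <= w; last by lra.
  by apply: (sup_ubound (proj2 supA)); split=> //; apply/andP; split; lra.
(* From now on [w] is used only as the last point where [G] equals [G p1]. *)
clearbody w.
have w0 : 0 < w := lt_le_trans (le_lt_trans p00 p01) wp1.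
have [e [[e0 ew e1] [_ hr hS]]] := local_pure H w0 w1.
exists w; split=> //; last 2 first.
- by rewrite wp1.
- exists e; first by rewrite e0.
  case: hr => // hr; exfalso; apply: (notA (w + e)); lra.
case: hS => [//|[] h]; exfalso.
  have h1 := @mass_mono _ _ H (w - e) w ltac:(lra) ltac:(lra) ltac:(lra).
  have h2 := @mass_mono _ _ H w (w + e) ltac:(lra) ltac:(lra) ltac:(lra).
  by apply: (@notA (w + e)); lra.
have h0 := mass_mono H p00 (ltac:(lra) : p0 <= w) ltac:(lra).
have h2 := @mass_lip _ _ H w (w + e) ltac:(lra) ltac:(lra) ltac:(lra).
have [pe|pe] := leP p0 (w - e).
  have h1 := mass_mono H p00 pe.
  have := @mass_lip _ _ H (w - e) w ltac:(lra) ltac:(lra) ltac:(lra).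
  lra.
have h1 := @mass_lip _ _ H (w - e) p0 ltac:(lra) ltac:(lra) ltac:(lra).
lra.
Qed.

Lemma full_until G S p0 p1 : mass_profile G S ->
  0 <= p0 -> p0 < p1 -> p1 < 1 -> G p1 - G p0 = p1 - p0 ->
  G 1 - G p1 < 1 - p1 ->
  exists w, [/\ S w, p1 <= w < 1, G w - G p1 = w - p1 &
    exists2 e : R, 0 < e < 1 - w & G (w + e) = G w].
Proof.
move=> H p00 p01 p11 Gp Gp1.
have [||w [Sw pw1 Gw [e ew Ge]]] :=
  null_until (mass_profile_compl H) p00 p01 p11; [lra..|].
by exists w; split=> //; [|exists e => //]; lra.
Qed.

Lemma null_since G S p0 p1 : mass_profile G S ->
  0 < p1 -> p1 < p0 -> p0 <= 1 -> G p1 = G p0 -> 0 < G p1 ->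
  exists w, [/\ S w, 0 < w <= p1 & G w = G p1].
Proof.
move=> H p10 p01 p00 Gp Gp1.
have [|||||w [Sw pw1 Gw _]] :=
  @null_until _ _ (1 - p0) (1 - p1) (mass_profile_refl H).
all: rewrite ?subrr ?(mass0 H) ?subKr; try lra.
exists (1 - w); split=> //; last by rewrite subKr in Gw; lra.
lra.
Qed.

Lemma full_since G S p0 p1 : mass_profile G S ->
  0 < p1 -> p1 < p0 -> p0 <= 1 -> G p0 - G p1 = p0 - p1 -> G p1 < p1 ->
  exists w, [/\ S w, 0 < w <= p1 & G p1 - G w = p1 - w].
Proof.
move=> H p10 p01 p00 Gp Gp1.
have [||w [Sw pw1 Gw]] :=
  null_since (mass_profile_compl H) p10 p01 p00; [lra..|].
by exists w; split=> //; lra.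
Qed.

End MassProfile.

(** * Lower bounds for the cost of the crossings *)

Section Bounds.
Context {R : realType}.
Implicit Types (I G : R -> R) (S : set R).

(** Finitely many crossings suffice for every bound, so that no infinite sum over
    [S] is needed. *)
Definition cost_ge I S (T : R) := exists xs : seq R,
  [/\ uniq xs, forall x, x \in xs -> S x & T <= \sum_(x <- xs) I x].

Lemma cost_ge2 I S T x y : S x -> S y -> x < y -> T <= I x + I y ->
  cost_ge I S T.
Proof.
move=> Sx Sy xy hT; exists [:: x; y]; split.
- by rewrite /= inE lt_eqF.
- by move=> z; rewrite !inE => /orP[] /eqP ->.
- by rewrite !big_cons big_nil addr0.
Qed.

Lemma cost_ge3 I S T x y z : S x -> S y -> S z -> x < y -> y < z ->
  T <= I x + I y + I z -> cost_ge I S T.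
Proof.
move=> Sx Sy Sz xy yz hT; exists [:: x; y; z]; split.
- by rewrite /= !inE !lt_eqF// (lt_trans xy).
- by move=> t; rewrite !inE => /or3P[] /eqP ->.
- by rewrite !big_cons big_nil addr0 addrA.
Qed.

Lemma cost_ge4 I S T x y z t : S x -> S y -> S z -> S t ->
  x < y -> y < z -> z < t ->
  T <= I x + I y + I z + I t -> cost_ge I S T.
Proof.
move=> Sx Sy Sz St xy yz zt hT; exists [:: x; y; z; t]; split.
- have xz := lt_trans xy yz; have yt := lt_trans yz zt.
  by rewrite /= !inE !lt_eqF// (lt_trans xz).
- by move=> u; rewrite !inE => /or4P[] /eqP ->.
- by rewrite !big_cons big_nil addr0 !addrA.
Qed.

(** [E] is null or full just below [r = G 1].  If it is null, the crossing [y]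
    that ends the null stretch on the left has the mass [s] below it, so that
    [s <= y <= r], and the crossing [w] on the right has the mass [r - s] above
    it, so that [r <= w <= 1 - (r - s)].  If it is full, the same counting
    applied to the full stretch [(y, z)] around [r] gives [r - s <= y <= r] and
    [r <= z <= 2 * r - s]. *)
Lemma tails_bound I G S s : iso_profile I -> mass_profile G S ->
  G (G 1) = s -> G 1 <= s + s -> s < G 1 -> G 1 <= 1 / 2 ->
  cost_ge I S (I s + I (G 1 - s)).
Proof.
move=> HI H; move Er : (G 1) => r Gr rs sr r2.
have [r0 r1] : 0 < r /\ r < 1 by lra.
have [e [[e0 er e1] [hl _ _]]] := local_pure H r0 r1.
case: hl => hl.
- have [|||||y [Sy /andP[y0 yr] Gy]] := @null_since _ _ _ r (r - e) H; try lra.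
  have [|||||w [Sw /andP[rw w1] Gw _]] := @null_until _ _ _ (r - e) r H; try lra.
  have hy := @mass_lip _ _ _ H 0 y ltac:(lra) ltac:(lra) ltac:(lra).
  rewrite (mass0 H) in hy.
  have hw := @mass_lip _ _ _ H w 1 ltac:(lra) ltac:(lra) ltac:(lra).
  apply: (cost_ge2 Sy Sw); first lra.
  have := @iso_deeper _ _ HI s y ltac:(lra) ltac:(lra) ltac:(lra).
  have := @iso_deeper _ _ HI (r - s) w ltac:(lra) ltac:(lra) ltac:(lra).
  lra.
have [|||||y [Sy /andP[y0 yr] Gy]] := @full_since _ _ _ r (r - e) H; try lra.
have [|||||z [Sz /andP[rz z1] Gz _]] := @full_until _ _ _ (r - e) r H; try lra.
have hy := @mass_mono _ _ _ H 0 y ltac:(lra) ltac:(lra) ltac:(lra).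
rewrite (mass0 H) in hy.
have hz := @mass_mono _ _ _ H z 1 ltac:(lra) ltac:(lra) ltac:(lra).
apply: (cost_ge2 Sy Sz); first lra.
have := @iso_deeper _ _ HI (r - s) y ltac:(lra) ltac:(lra) ltac:(lra).
have := @iso_deeper _ _ HI s z ltac:(lra) ltac:(lra) ltac:(lra).
lra.
Qed.

(** Just after the end [q] of a component the mass [G 1 - G q] is still to come, and
    the crossing [w] where it begins lies at depth at least [G 1 - G q]; by
    subadditivity the remaining crossings cost as much as if that mass were moved
    next to [q]. *)
Lemma right_end_cost I G S q e : iso_profile I -> mass_profile G S ->
  0 <= q -> 0 < e -> e < 1 - q -> G (q + e) = G q -> G 1 - G q <= q ->
  exists2 c, I (q + (G 1 - G q)) <= c &
    c = I q \/ (exists w, [/\ S w, q < w & c = I q + I w]).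
Proof.
move=> HI H q0 e0 e1 Ge Gq1.
have hq := @mass_mono _ _ _ H q 1 ltac:(lra) ltac:(lra) ltac:(lra).
have [Gq|Gq] := leP (G 1) (G q).
  by exists (I q); [rewrite (_ : q + _ = q)//; lra|left].
have [|||||w [Sw /andP[qw w1] Gw _]] := @null_until _ _ _ q (q + e) H; try lra.
have hw := @mass_lip _ _ _ H w 1 ltac:(lra) ltac:(lra) ltac:(lra).
have Iw := @iso_deeper _ _ HI (G 1 - G q) w ltac:(lra) ltac:(lra) ltac:(lra).
have Iq := @iso_subadd _ _ HI q (G 1 - G q) ltac:(lra) ltac:(lra) ltac:(lra).
exists (I q + I w); first lra.
by right; exists w; split=> //; lra.
Qed.

(** If [E] is full just below [r], the full stretch [(y, z)] around [r] satisfies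
    [r - s <= y], and the mass beyond [z] moved next to [z] would end at
    [2 * r - s]. *)
Lemma interval_bound_full I G S r s e : iso_profile I -> mass_profile G S ->
  G 1 = r -> G r = s -> 0 < e -> e < r -> G r - G (r - e) = e ->
  0 <= s -> s < r -> r < 1 / 2 -> cost_ge I S (I (r - s) + I (2 * r - s)).
Proof.
move=> HI H Er Gr e0 er hl s0 sr r2.
have [|||||y [Sy /andP[y0 yr] Gy]] := @full_since _ _ _ r (r - e) H; try lra.
have [|||||z [Sz /andP[rz z1] Gz [d /andP[d0 d1] Gd]]] :=
  @full_until _ _ _ (r - e) r H; try lra.
have hy := @mass_mono _ _ _ H 0 y ltac:(lra) ltac:(lra) ltac:(lra).
rewrite (mass0 H) in hy.
have Iy := @iso_deeper _ _ HI (r - s) y ltac:(lra) ltac:(lra) ltac:(lra).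
have yz : y < z by lra.
have Gz1 : z + (G 1 - G z) = 2 * r - s by lra.
have [||c Ic hc] := right_end_cost HI H _ d0 d1 Gd; [lra|lra|].
rewrite Gz1 in Ic.
case: hc => [cE|[w [Sw zw cE]]]; rewrite cE in Ic.
  by apply: (cost_ge2 Sy Sz yz); lra.
by apply: (cost_ge3 Sy Sz Sw yz zw); lra.
Qed.

(** If [E] is null just below [r], its next component [(p, q)] starts at or after
    [r], and the mass beyond [q] moved next to [q] would end at [p + (r - s)].  The
    crossing before [r], which exists when [s > 0], costs at least [I s].  The
    conclusion is then [iso_shift]. *)
Lemma interval_bound_null I G S r s e : iso_profile I -> mass_profile G S ->
  G 1 = r -> G r = s -> 0 < e -> e < r -> G r = G (r - e) ->
  0 <= s -> s + s < r -> 3 * r <= 1 + 2 * s -> r - s <= G (1 - r) ->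
  cost_ge I S (I (r - s) + I (2 * r - s)).
Proof.
move=> HI H Er Gr e0 er hl s0 sr r3 Gr'.
have cost_left : s = 0 \/ exists y, [/\ S y, y < r & I s <= I y].
  have [s00|s00] := leP s 0; [by left; lra|right].
  have [|||||y [Sy /andP[y0 yr] Gy]] := @null_since _ _ _ r (r - e) H; try lra.
  have hy := @mass_lip _ _ _ H 0 y ltac:(lra) ltac:(lra) ltac:(lra).
  rewrite (mass0 H) in hy.
  have Iy := @iso_deeper _ _ HI s y ltac:(lra) ltac:(lra) ltac:(lra).
  by exists y; split=> //; lra.
have [|||||p [Sp /andP[rp p1] Gp [d /andP[d0 d1] Gd]]] :=
  @null_until _ _ _ (r - e) r H; try lra.
have pr : p < 1 - r.
  rewrite ltNge; apply/negP => pr.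
  by have := mass_mono H _ pr; lra.
(* At most [s] of the mass [r - s] that lies above [p] is above [1 - r]. *)
have pr2 : p <= 1 - 2 * r + 2 * s.
  by have := @mass_lip _ _ _ H p (1 - r); lra.
have [|||||q [Sq /andP[pq' q1] Gq [d' /andP[d'0 d'1] Gd']]] :=
  @full_until _ _ _ p (p + d) H; try lra.
have pq : p < q by lra.
have Gq1 : q + (G 1 - G q) = p + (r - s) by lra.
have [||c Ic hc] := right_end_cost HI H _ d'0 d'1 Gd'; [lra|lra|].
have cost_mid := iso_shift HI s0 sr r3 rp pr2.
rewrite Gq1 in Ic; move: s0 (iso0 HI) Sp Sq rp pq Ic hc cost_mid cost_left; clear.
move=> s0 I0 Sp Sq rp pq Ic hc cost_mid [s00|[y [Sy yr Iy]]].
  rewrite s00 I0 in cost_mid *.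
  case: hc => [cE|[w [Sw qw cE]]]; rewrite cE in Ic.
    by apply: (cost_ge2 Sp Sq pq); rewrite s00 in Ic; lra.
  by apply: (cost_ge3 Sp Sq Sw pq qw); rewrite s00 in Ic; lra.
have yp : y < p by lra.
case: hc => [cE|[w [Sw qw cE]]]; rewrite cE in Ic.
  by apply: (cost_ge3 Sy Sp Sq yp pq); lra.
by apply: (cost_ge4 Sy Sp Sq Sw yp pq qw); lra.
Qed.

Lemma interval_bound I G S s : iso_profile I -> mass_profile G S ->
  G (G 1) = s -> 0 <= s -> s + s < G 1 -> 3 * G 1 <= 1 + 2 * s ->
  G 1 - s <= G (1 - G 1) ->
  cost_ge I S (I (G 1 - s) + I (2 * G 1 - s)).
Proof.
move=> HI H; move Er : (G 1) => r Gr s0 sr r3 Gr'.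
have [r0 r1] : 0 < r /\ r < 1 by lra.
have [e [[e0 er e1] [hl _ _]]] := local_pure H r0 r1.
case: hl => hl; first exact: (interval_bound_null HI H Er Gr e0 er hl).
by apply: (interval_bound_full HI H Er Gr e0 er hl); lra.
Qed.
End Bounds.

(** * Prescribed mass and asymmetry *)

Section Cost.
Context {R : realType}.
Implicit Types (I G : R -> R) (S : set R).

Lemma cost_ge_refl I S T : iso_profile I ->
  cost_ge I [set x | S (1 - x)] T -> cost_ge I S T.
Proof.
move=> HI [xs [uxs Sxs hT]]; exists [seq 1 - x | x <- xs]; split.
- by rewrite map_inj_uniq// => x y; lra.
- by move=> _ /mapP[x xxs ->]; exact: Sxs.
- by rewrite big_map; under eq_bigr do rewrite (iso_sym HI).
Qed.

(** The two terms are the masses of the symmetric differences with the half-lines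
    ]-oo, F^-1 r[ and ]F^-1 (1 - r), +oo[ of the same mass [r = G 1]. *)
Definition mass_asymmetry G := Num.min (2 * (G 1 - G (G 1))) (2 * G (1 - G 1)).

(** Up to reflection, the closest half-line of the same mass is the left one. *)
Lemma mass_profile_orient G S : mass_profile G S -> exists G' S',
  [/\ mass_profile G' S', G' 1 = G 1, G' (G 1) = G 1 - mass_asymmetry G / 2,
      mass_asymmetry G / 2 <= G' (1 - G 1) &
      forall I T, iso_profile I -> cost_ge I S' T -> cost_ge I S T].
Proof.
move=> H; rewrite /mass_asymmetry.
case: (leP (2 * (G 1 - G (G 1))) (2 * G (1 - G 1))) => h.
  by exists G, S; split=> //; lra.
exists (fun x => G 1 - G (1 - x)), [set x | S (1 - x)]; split.
- exact: mass_profile_refl.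
- by rewrite subrr (mass0 H) subr0.
- lra.
- by rewrite subKr; lra.
- by move=> I T; exact: cost_ge_refl.
Qed.

Lemma interval_cost I G S r lam : iso_profile I -> mass_profile G S ->
  G 1 = r -> mass_asymmetry G = lam -> 0 < r -> r < lam -> lam <= 2 * r ->
  lam <= 1 - r -> cost_ge I S (I (lam / 2) + I (r + lam / 2)).
Proof.
move=> HI H rE lE r0 rl l2r l1r.
have [G' [S' [H' G'1 G'r G'r' hS]]] := mass_profile_orient H; apply: hS => //.
rewrite rE lE in G'1 G'r G'r'.
rewrite (_ : I (lam / 2) = I (G' 1 - (r - lam / 2))); last by congr I; lra.
rewrite (_ : r + lam / 2 = 2 * G' 1 - (r - lam / 2)); last by lra.
by apply: interval_bound => //; rewrite ?G'1; lra.
Qed.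

Lemma tails_cost I G S r lam : iso_profile I -> mass_profile G S ->
  G 1 = r -> mass_asymmetry G = lam -> 0 < lam -> lam <= r -> r <= 1 / 2 ->
  cost_ge I S (I (r - lam / 2) + I (1 - lam / 2)).
Proof.
move=> HI H rE lE l0 lr r2.
have [G' [S' [H' G'1 G'r G'r' hS]]] := mass_profile_orient H; apply: hS => //.
rewrite rE lE in G'1 G'r G'r'; rewrite (iso_sym HI).
rewrite (_ : I (lam / 2) = I (G' 1 - (r - lam / 2))); last by congr I; lra.
by apply: tails_bound => //; rewrite ?G'1; lra.
Qed.

Lemma mass_asymmetry_compl G : mass_asymmetry (fun x => x - G x) = mass_asymmetry G.
Proof. by rewrite /mass_asymmetry !subKr minC. Qed.
End Cost.

(** * Lebesgue measure and the essential boundary *)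

Section RealLine.
Context {R : realType}.

Lemma near_dist (y e : R) : 0 < e -> \forall t \near y, `|t - y| <= e.
Proof.
move=> e0; have yy : (t @[t --> y] --> y)%classic by exact: cvg_id.
have /cvgrPdist_le/(_ _ e0) := yy.
by apply: filterS => t; rewrite distrC.
Qed.

Lemma lipschitz_continuous (K : R) (k : R -> R) : 0 < K ->
  (forall x y, x <= y -> `|k x - k y| <= K * (y - x)) -> continuous k.
Proof.
move=> K0 hk x; apply/cvgrPdist_le => e e0.
have eK : 0 < e / K by rewrite divr_gt0.
apply: filterS (near_dist x eK) => t; rewrite ler_pdivlMr// mulrC => te.
rewrite (le_trans _ te)//; have [xt|/ltW tx] := leP x t.
  by rewrite (ger0_norm (x := t - x)) ?subr_ge0// hk.
by rewrite distrC (distrC t) (ger0_norm (x := x - t)) ?subr_ge0// hk.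
Qed.
End RealLine.

Section Lebesgue.
Context {R : realType}.
Local Notation leb := (@completed_lebesgue_measure R).
Implicit Types (A E : set (lebesgueTypeR R)).

Lemma lebesgue_measurable_borel (A : set R) :
  measurable (A : set (measurableTypeR R)) ->
  measurable (A : set (lebesgueTypeR R)).
Proof. exact: sub_caratheodory. Qed.

Lemma measurable_litv (i : interval R) :
  measurable ([set` i] : set (lebesgueTypeR R)).
Proof. by apply: lebesgue_measurable_borel; exact: measurable_itv. Qed.
Hint Resolve measurable_litv : core.

(** The Lebesgue measure and its completion are the same outer measure restricted
    to two sigma-algebras. *)
Lemma leb_itv (i : interval R) : leb [set` i] = lebesgue_measure [set` i].
Proof. by []. Qed.

Lemma leb_itvE (x y : R) (bx by_ : bool) : x <= y ->
  leb [set` Interval (BSide bx x) (BSide by_ y)] = (y - x)%:E.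
Proof.
rewrite leb_itv lebesgue_measure_itv/= lte_fin.
by case: ltgtP => //= -> _; rewrite subrr.
Qed.

Lemma leb_set1 (x : R) : leb [set x] = 0%E.
Proof. by rewrite -set_itv1 leb_itvE// subrr. Qed.

Lemma leb_setI_itv_fin E (i : interval R) (x y : R) bx by_ :
  i = Interval (BSide bx x) (BSide by_ y) -> measurable E ->
  leb (E `&` [set` i]) \is a fin_num.
Proof.
move=> -> mE; have [xy|xy] := leP x y; last first.
  rewrite set_itv_ge ?setI0 ?measure0//.
  by case: bx by_ => -[]; rewrite bnd_simp -?ltNge -?leNgt// ltW.
rewrite ge0_fin_numE ?measure_ge0// (@le_lt_trans _ _ (y - x)%:E) ?ltry//.
by rewrite -(leb_itvE bx by_ xy) le_measure ?inE//; exact: measurableI.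
Qed.

Definition lebI E (x y : R) : R := fine (leb (E `&` `]x, y])).

Lemma lebIE E x y : measurable E -> (lebI E x y)%:E = leb (E `&` `]x, y]).
Proof. by move=> mE; rewrite fineK//; exact: (leb_setI_itv_fin erefl). Qed.

Lemma lebI_ge0 E x y : 0 <= lebI E x y.
Proof. by rewrite fine_ge0// measure_ge0. Qed.

Lemma lebI_le E x y : measurable E -> x <= y -> lebI E x y <= y - x.
Proof.
move=> mE xy; rewrite -lee_fin lebIE// -(leb_itvE false false xy).
by rewrite le_measure ?inE//; exact: measurableI.
Qed.

Lemma lebI_split E x y z : measurable E -> x <= y -> y <= z ->
  lebI E x z = lebI E x y + lebI E y z.
Proof.
move=> mE xy yz; apply/EFin_inj; rewrite EFinD !lebIE//.
rewrite -measureU//; [|exact: measurableI|exact: measurableI|].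
- rewrite -setIUr -itv_bndbnd_setU// bnd_simp//.
- apply/seteqP; split=> // t [[_ /=]]; rewrite in_itv/= => /andP[_ ty] [_ /=].
  by rewrite in_itv/= ltNge ty.
Qed.

Lemma lebI_compl E x y : measurable E -> x <= y ->
  lebI E x y + lebI (~` E) x y = y - x.
Proof.
move=> mE xy; apply/EFin_inj; rewrite EFinD !lebIE//; last exact: measurableC.
rewrite -measureU//.
- by rewrite -setIUl setUv setTI; exact: leb_itvE.
- by apply: measurableI => //; exact: measurable_litv.
- by apply: measurableI; [exact: measurableC|exact: measurable_litv].
- by apply/seteqP; split=> // t [[Et _] []].
Qed.

Lemma leb_ball E z rho : measurable E -> 0 < rho ->
  leb (E `&` ball z rho) = (lebI E (z - rho) (z + rho))%:E.
Proof.
move=> mE r0; rewrite lebIE// ball_itv.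
apply/eqP; rewrite eq_le; apply/andP; split.
  rewrite le_measure ?inE//; [exact: measurableI|exact: measurableI|].
  by apply: setIS; apply: subset_itvl; rewrite bnd_simp.
rewrite (@le_trans _ _ (leb ((E `&` `]z - rho, z + rho[) `|` [set z + rho])))//.
  rewrite le_measure ?inE//; first exact: measurableI.
    by apply: measurableU; [exact: measurableI|rewrite -set_itv1; exact: measurable_litv].
  move=> t [Et /=]; rewrite !in_itv/= => /andP[-> tz].
  by move: tz; rewrite le_eqVlt => /predU1P[->|->]; [right|left].
rewrite (le_trans (measureU2 _ _ _))//.
- exact: measurableI.
- by rewrite -set_itv1; exact: measurable_litv.
- by rewrite [X in (_ + X)%E](_ : _ = 0%E) ?adde0//; exact: leb_set1.
Qed.

(** Balls are traded for half-open intervals, on which [lebI] is additive. *)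
Lemma density_bounds E z d lo hi : measurable E -> density_points E d z ->
  (\forall rho \near (0:R)^'+,
    lo * (rho + rho) <= lebI E (z - rho) (z + rho) <= hi * (rho + rho)) ->
  lo <= d <= hi.
Proof.
move=> mE Ed near_lohi; rewrite -!lee_fin -(cvg_lim _ Ed)//.
have cE := cvgP _ Ed.
have ratioE : \forall rho \near (0:R)^'+,
    (leb (E `&` ball z rho) * (leb (ball z rho))^-1)%E =
    (lebI E (z - rho) (z + rho) / (rho + rho))%:E.
  near=> rho; have r0 : 0 < rho by near: rho; exact: nbhs_right_gt.
  rewrite leb_ball// ball_itv leb_itvE; last by lra.
  rewrite (_ : z + rho - (z - rho) = rho + rho); last by lra.
  by rewrite inver gt_eqF ?addr_gt0.
apply/andP; split; [apply: lime_ge|apply: lime_le] => //;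
  apply: filterS3 ratioE near_lohi (nbhs_right_gt 0) => rho -> /andP[h1 h2] r0.
- by rewrite lee_fin ler_pdivlMr ?addr_gt0.
- by rewrite lee_fin ler_pdivrMr ?addr_gt0.
Unshelve. all: by end_near. Qed.

Lemma half_density_ess_boundary E z theta delta : measurable E ->
  0 < theta < 1 -> 0 < delta ->
  (forall rho, 0 < rho -> rho < delta ->
    theta * rho <= lebI E (z - rho) (z + rho) <= theta * rho + rho) ->
  ess_boundary E z.
Proof.
move=> mE /andP[t0 t1] d0 h.
have near_h : \forall rho \near (0:R)^'+,
    (theta / 2) * (rho + rho) <= lebI E (z - rho) (z + rho)
      <= ((theta + 1) / 2) * (rho + rho).
  near=> rho.
  have r0 : 0 < rho by near: rho; exact: nbhs_right_gt.
  have rd : rho < delta by near: rho; exact: nbhs_right_lt.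
  by have /andP[] := h _ r0 rd => *; apply/andP; split; lra.
by case => /(density_bounds mE) /(_ near_h); lra.
Unshelve. all: by end_near. Qed.

(** Let [theta] be the fraction of ]c, d] that [E] fills.  The function
    [k x = |E n ]c, x]| - theta * (x - c)] vanishes at [c] and at [d], hence has an
    extremum [z] inside.  On one side of [z] the set [E] fills at least the
    fraction [theta] of every small interval ending at [z], on the other side at
    most [theta]; so its density at [z], if any, lies between [theta / 2] and
    [(1 + theta) / 2]. *)
Lemma ess_boundary_between E c d : measurable E -> c < d ->
  0 < lebI E c d -> lebI E c d < d - c ->
  exists z, [/\ c < z, z < d & ess_boundary E z].
Proof.
move=> mE cd h0 h1.
have dc : 0 < d - c by lra.
pose theta := lebI E c d / (d - c).
have tE : theta * (d - c) = lebI E c d by rewrite divfK// gt_eqF.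
have t0 : 0 < theta by rewrite divr_gt0.
have t1 : theta < 1 by rewrite ltr_pdivrMr// mul1r.
(* Taking the maximum with [c] makes [H] nonexpansive on the whole line. *)
pose H x := lebI E c (Num.max c x).
pose k x := H x - theta * (x - c).
have HE x : c <= x -> H x = lebI E c x by move=> cx; rewrite /H max_r.
have Hlip x y : x <= y -> 0 <= H y - H x <= y - x.
  move=> xy; have mm : Num.max c x <= Num.max c y.
    by rewrite ge_max !le_max lexx xy orbT.
  have cm : c <= Num.max c x by rewrite le_max lexx.
  rewrite /H (lebI_split mE cm mm).
  have h2 := lebI_ge0 E (Num.max c x) (Num.max c y).
  have h3 := lebI_le mE mm.
  apply/andP; split; first lra.
  have : Num.max c y - Num.max c x <= y - x by case: (leP c x); case: (leP c y); lra.
  lra.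
have kc : continuous k.
  move=> x; apply: cvgB; last first.
    by apply: cvgMr; apply: cvgB; [exact: cvg_id|exact: cvg_cst].
  apply: (@lipschitz_continuous _ 1) => // u v uv; rewrite mul1r.
  by have /andP[*] := Hlip _ _ uv; rewrite ler_norml; lra.
have kw : {within `[c, d], continuous k} := continuous_subspaceT kc.
have kc0 : k c = 0.
  rewrite /k HE// subrr mulr0 subr0; apply/eqP; rewrite eq_le lebI_ge0 andbT.
  by rewrite -[leRHS](subrr c) lebI_le.
have kd0 : k d = 0 by rewrite /k HE ?(ltW cd)// tE subrr.
suff [z [cz zd hz]] : exists z, [/\ c < z, z < d &
    (forall x, c <= x <= d -> k x <= k z) \/
    (forall x, c <= x <= d -> k z <= k x)].
  exists z; split=> //.
  apply: (@half_density_ess_boundary _ _ theta (Num.min (z - c) (d - z))) => //.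
  - by rewrite t0.
  - by rewrite lt_min !subr_gt0 cz.
  move=> rho r0; rewrite lt_min => /andP[rc rd].
  rewrite (@lebI_split _ _ z)//; [|lra|lra].
  have e1 : H z - H (z - rho) = lebI E (z - rho) z.
    by rewrite !HE ?(@lebI_split E c (z - rho) z)//; lra.
  have e2 : H (z + rho) - H z = lebI E z (z + rho).
    by rewrite !HE ?(@lebI_split E c z (z + rho))//; lra.
  have /andP[a1 a2] := Hlip (z - rho) z ltac:(lra).
  have /andP[b1 b2] := Hlip z (z + rho) ltac:(lra).
  have [hz1 hz2] : c <= z - rho <= d /\ c <= z + rho <= d by lra.
  rewrite /k in hz; rewrite -e1 -e2.
  by case: hz => hz; move: (hz _ hz1) (hz _ hz2) => ? ?; apply/andP; split; lra.
have [z1 z1cd max1] := EVT_max (ltW cd) kw.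
have [z2 z2cd min2] := EVT_min (ltW cd) kw.
rewrite !in_itv/= in z1cd z2cd.
have [k1|k1] := ltP 0 (k z1).
  exists z1; split.
  - by rewrite lt_neqAle (andP z1cd).1 andbT; apply: contraTneq k1 => <-; rewrite kc0 ltxx.
  - by rewrite lt_neqAle (andP z1cd).2 andbT; apply: contraTneq k1 => ->; rewrite kd0 ltxx.
  - by left => x xcd; apply: max1; rewrite in_itv.
have [k2|k2] := ltP (k z2) 0.
  exists z2; split.
  - by rewrite lt_neqAle (andP z2cd).1 andbT; apply: contraTneq k2 => <-; rewrite kc0 ltxx.
  - by rewrite lt_neqAle (andP z2cd).2 andbT; apply: contraTneq k2 => ->; rewrite kd0 ltxx.
  - by right => x xcd; apply: min2; rewrite in_itv.
(* Here [k] is constant on [c, d] and every interior point will do. *)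
exists ((c + d) / 2); split; [lra|lra|left => x xcd].
have hx := max1 x; rewrite in_itv/= in hx.
have hm := min2 ((c + d) / 2); rewrite in_itv/= in hm.
have := hx xcd; have := hm ltac:(lra); lra.
Qed.
End Lebesgue.

Section Interval.
Context {R : realType}.
Implicit Types (u v : \bar R) (x y z : R).

Lemma eitvP u v x : eitv u v x <-> (u < x%:E < v)%E.
Proof. by rewrite /eitv /= in_itv. Qed.

Lemma eitv_between u v x y z : eitv u v x -> eitv u v z ->
  x <= y -> y <= z -> eitv u v y.
Proof.
rewrite !eitvP => /andP[ux xv] /andP[uz zv] xy yz.
by rewrite (lt_le_trans ux) ?lee_fin//= (le_lt_trans _ zv) ?lee_fin.
Qed.

Lemma eitv_open u v : open (eitv u v).
Proof.
rewrite (_ : eitv u v = [set x | (u < x%:E)%E] `&` [set x | (x%:E < v)%E]).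
  by apply: openI; [exact: open_ereal_gt|exact: open_ereal_lt].
by apply/seteqP; split=> x; rewrite /eitv /= in_itv/= => /andP.
Qed.

Lemma eitv_near u v y : eitv u v y ->
  exists2 h : R, 0 < h & forall t, `|t - y| <= h -> eitv u v t.
Proof.
move=> uvy; have /nbhs_ballP[e /= e0 he] := open_nbhs_nbhs (conj (@eitv_open u v) uvy).
exists (e / 2); first by rewrite divr_gt0.
move=> t ht; apply: he; rewrite /ball/= distrC (le_lt_trans ht)//.
by rewrite ltr_pdivrMr// ltr_pMr// ltr1n.
Qed.
End Interval.

(** * Mass of a set on intervals *)

Section Measure.
Context {R : realType}.
Local Notation leb := (@completed_lebesgue_measure R).
Variables (mu : probability (lebesgueTypeR R) R).
Implicit Types (E A : set (lebesgueTypeR R)) (x y : R).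

Definition muI E x y : R := fine (mu (E `&` `]x, y])).
Definition cdfI E x : R := fine (mu (E `&` `]-oo, x])).

Lemma mu_fin E : measurable E -> mu E \is a fin_num.
Proof. by move=> mE; exact: fin_num_measure. Qed.

Lemma muIE E x y : measurable E -> (muI E x y)%:E = mu (E `&` `]x, y]).
Proof.
move=> mE; rewrite fineK//; apply: mu_fin.
by apply: measurableI => //; exact: measurable_litv.
Qed.

Lemma cdfIE E x : measurable E -> (cdfI E x)%:E = mu (E `&` `]-oo, x]).
Proof.
move=> mE; rewrite fineK//; apply: mu_fin.
by apply: measurableI => //; exact: measurable_litv.
Qed.

Lemma cdfI_setT x : cdfI setT x = cdfR mu x.
Proof. by rewrite /cdfI setTI. Qed.

Lemma muI_ge0 E x y : 0 <= muI E x y.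
Proof. by rewrite fine_ge0// measure_ge0. Qed.

Lemma cdfI_split E x y : measurable E -> x <= y ->
  cdfI E y = cdfI E x + muI E x y.
Proof.
move=> mE xy; apply/EFin_inj; rewrite EFinD !cdfIE// muIE//.
rewrite -measureU//.
- rewrite -setIUr -itv_bndbnd_setU// bnd_simp//.
- by apply: measurableI => //; exact: measurable_litv.
- by apply: measurableI => //; exact: measurable_litv.
- apply/seteqP; split=> // t [[_ /=]]; rewrite in_itv/= => ty [_ /=].
  by rewrite in_itv/= ltNge ty.
Qed.

Lemma muI_compl E x y : measurable E ->
  muI E x y + muI (~` E) x y = muI setT x y.
Proof.
move=> mE; apply/EFin_inj; rewrite EFinD !muIE//; last exact: measurableC.
rewrite -measureU//.
- by rewrite -setIUl setUv.
- by apply: measurableI => //; exact: measurable_litv.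
- by apply: measurableI; [exact: measurableC|exact: measurable_litv].
- by apply/seteqP; split=> // t [[Et _] []].
Qed.

Lemma muI_setT x y : x <= y -> muI setT x y = cdfR mu y - cdfR mu x.
Proof.
by move=> xy; rewrite -!cdfI_setT (cdfI_split measurableT xy) addrC addKr.
Qed.

Lemma cdf_mono x y : x <= y -> cdfR mu x <= cdfR mu y.
Proof. by move=> xy; have := muI_ge0 setT x y; rewrite muI_setT// subr_ge0. Qed.

Lemma cdf_ge0 x : 0 <= cdfR mu x.
Proof. by rewrite fine_ge0// measure_ge0. Qed.

Lemma cdf_le1 x : cdfR mu x <= 1.
Proof.
rewrite -lee_fin fineK; last by apply: mu_fin; exact: measurable_litv.
exact: probability_le1 (measurable_litv _).
Qed.

End Measure.

(** * Symmetric log-concave densities *)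

Section LogConcaveMeasure.
Context {R : realType}.
Local Notation leb := (@completed_lebesgue_measure R).
Variables (mu : probability (lebesgueTypeR R) R).
Variables (f : R -> R) (a b : \bar R).
Hypothesis f_density : is_density mu f.
Hypothesis f_pos : forall x, x \in eitv a b -> 0 < f x.
Hypothesis f_out : forall x, x \notin eitv a b -> f x = 0.
Hypothesis f_logconcave : log_concave f a b.
Hypothesis f_sym : forall x, f (- x) = f x.
Implicit Types (E A : set (lebesgueTypeR R)).
Local Notation D := (eitv a b).
Local Notation F := (cdfR mu).
Local Notation Q := (cdfR_inv mu a b).

Lemma density_ge0 x : 0 <= f x.
Proof.
by have [/f_pos/ltW//|/f_out ->] := boolP (x \in D).
Qed.

Lemma density_gt0P x : 0 < f x <-> D x.
Proof.
split=> [|Dx]; last by apply: f_pos; rewrite inE.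
by have [|/f_out ->] := boolP (x \in D); rewrite ?inE// ltxx.
Qed.

Lemma density_support_opp x : D x -> D (- x).
Proof. by move=> /density_gt0P; rewrite -f_sym => /density_gt0P. Qed.

Lemma ln_density_concave x y z : D x -> D z -> x <= y -> y <= z ->
  (z - y) * ln (f x) + (y - x) * ln (f z) <= (z - x) * ln (f y).
Proof.
move=> Dx Dz xy yz; have Dy := eitv_between Dx Dz xy yz.
have [V Vconv fV] := f_logconcave.
have lnf t : D t -> ln (f t) = - V t by move=> Dt; rewrite fV ?inE// expRK.
rewrite !lnf//.
have [zx|zx] := leP z x.
  have -> : y = x by lra.
  have -> : z = x by lra.
  lra.
have zx0 : 0 < z - x by lra.
have t0 : 0 <= (z - y) / (z - x) by rewrite divr_ge0; lra.
have t1 : (z - y) / (z - x) <= 1 by rewrite ler_pdivrMr//; lra.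
have := Vconv (Itv01 t0 t1) x z; rewrite !inE => /(_ Dx Dz).
have e1 : (z - y) / (z - x) * (z - x) = z - y by rewrite divfK// gt_eqF.
set t := (z - y) / (z - x) in t0 t1 e1 * => Vt.
have {Vt} : V (t * x + (1 - t) * z) <= t * V x + (1 - t) * V z := Vt.
clearbody t; rewrite (_ : t * x + (1 - t) * z = y); last by lra.
have e2 : (1 - t) * (z - x) = y - x by lra.
rewrite -e1 -e2 => /(ler_wpM2l (ltW zx0)) h; lra.
Qed.

(** The supremum of the slopes of [ln f] to the right of [y] works: concavity
    makes it finite and at most every slope to the left of [y]. *)
Lemma ln_density_supergradient y : D y -> exists c, forall u, D u ->
  ln (f u) <= ln (f y) + c * (u - y).
Proof.
move=> Dy; have [h h0 hD] := eitv_near Dy.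
pose slope u := (ln (f u) - ln (f y)) / (u - y).
pose A := [set slope u | u in [set u | D u /\ y < u]].
have A0 : A !=set0.
  exists (slope (y + h)), (y + h) => //; split; last by lra.
  by apply: hD; rewrite addrC addKr gtr0_norm.
have ubA x : D x -> x < y -> ubound A ((ln (f y) - ln (f x)) / (y - x)).
  move=> Dx xy _ [u [Du yu] <-]; rewrite /slope.
  rewrite ler_pdivrMr ?subr_gt0// mulrAC ler_pdivlMr ?subr_gt0//.
  have := ln_density_concave Dx Du (ltW xy) (ltW yu); nra.
have hasA : has_ubound A.
  exists ((ln (f y) - ln (f (y - h))) / (y - (y - h))); apply: ubA; last by lra.
  by apply: hD; rewrite addrC addKr normrN gtr0_norm.
exists (sup A) => u Du; case: (ltgtP u y) => [uy|yu|->].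
- have : sup A <= (ln (f y) - ln (f u)) / (y - u) by apply: ge_sup => //; exact: ubA.
  rewrite ler_pdivlMr ?subr_gt0//; lra.
- have : slope u <= sup A by apply: ub_le_sup => //; exists u.
  rewrite /slope ler_pdivrMr ?subr_gt0//; lra.
- lra.
Qed.

(** [ln f] is Lipschitz near [y]: the supergradient bounds it from above, and the
    chords to [y - h] and [y + h] bound it from below. *)
Lemma density_continuous y : D y -> {for y, continuous f}.
Proof.
move=> Dy; have [h h0 hD] := eitv_near Dy.
have [c hc] := ln_density_supergradient Dy.
have Dp : D (y + h) by apply: hD; rewrite addrC addKr gtr0_norm.
have Dm : D (y - h) by apply: hD; rewrite addrC addKr normrN gtr0_norm.
pose K := `|c| + `|ln (f (y + h)) - ln (f y)| / h
  + `|ln (f (y - h)) - ln (f y)| / h.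
have K0 : 0 <= K by rewrite !addr_ge0// divr_ge0// ltW.
have lipL t : `|t - y| <= h -> `|ln (f t) - ln (f y)| <= K * `|t - y|.
  move=> th; have Dt := hD _ th; have hct := hc _ Dt.
  have q1 : `|ln (f (y + h)) - ln (f y)| / h * h = `|ln (f (y + h)) - ln (f y)|.
    by rewrite divfK// gt_eqF.
  have q2 : `|ln (f (y - h)) - ln (f y)| / h * h = `|ln (f (y - h)) - ln (f y)|.
    by rewrite divfK// gt_eqF.
  set p1 := _ / h in q1; set p2 := _ / h in q2.
  have p10 : 0 <= p1 by rewrite divr_ge0// ltW.
  have p20 : 0 <= p2 by rewrite divr_ge0// ltW.
  have ct : c * (t - y) <= `|c| * `|t - y| by rewrite -normrM ler_norm.
  have n1 := ler_norm (- (ln (f (y + h)) - ln (f y))).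
  have n2 := ler_norm (- (ln (f (y - h)) - ln (f y))).
  rewrite normrN -q1 in n1; rewrite normrN -q2 in n2.
  have KE : K = `|c| + p1 + p2 by [].
  have c0 := normr_ge0 c; have t0 := normr_ge0 (t - y).
  rewrite ler_norml; apply/andP; split; last by rewrite KE; nra.
  have [ty|ty] := leP y t.
    rewrite ger0_norm ?subr_ge0// in th t0 ct *.
    have := ln_density_concave Dy Dp ty ltac:(lra) => hcv.
    have : - (p1 * (t - y)) <= ln (f t) - ln (f y).
      by rewrite -(ler_pM2l h0); nra.
    rewrite KE; nra.
  rewrite ltr0_norm ?subr_lt0// in th t0 ct *.
  have yht : y - h <= t by lra.
  have := ln_density_concave Dm Dy yht (ltW ty) => hcv.
  have : - (p2 * - (t - y)) <= ln (f t) - ln (f y).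
    by rewrite -(ler_pM2l h0); nra.
  rewrite KE; nra.
have cln : ln (f t) @[t --> y] --> ln (f y).
  apply/cvgrPdist_le => e e0; have eK : 0 < e / (K + 1) by rewrite divr_gt0//; lra.
  apply: filterS2 (near_dist y h0) (near_dist y eK) => t th.
  rewrite ler_pdivlMr => [te|]; last by lra.
  rewrite distrC (le_trans (lipL t th))// (le_trans _ te)// mulrC.
  by rewrite ler_wpM2l// lerDl.
have : expR (ln (f t)) @[t --> y] --> expR (ln (f y)).
  by apply: (cvg_comp _ _ cln); exact: continuous_expR.
rewrite lnK; last by rewrite posrE; exact/density_gt0P.
apply: cvg_trans; apply: near_eq_cvg.
have Dnear := open_nbhs_nbhs (conj (@eitv_open _ a b) Dy).
by near=> t; rewrite /= lnK// posrE; apply/density_gt0P; near: t.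
Unshelve. all: by end_near. Qed.

Lemma density_le_max x : D 0 -> f x <= f 0.
Proof.
move=> D0; have [|/f_out ->] := boolP (x \in D); last exact: density_ge0.
rewrite inE => Dx; have D'x := density_support_opp Dx.
rewrite -ler_ln ?posrE; [|exact/density_gt0P..].
wlog x0 : x Dx D'x / 0 <= x => [hw|].
  have [/hw|x0] := leP 0 x; first exact.
  by rewrite -(f_sym x); apply: hw; rewrite ?opprK//; lra.
have := ln_density_concave D'x Dx (ltac:(lra) : - x <= 0) x0.
rewrite f_sym; have [->|xn0] := eqVneq x 0; first by [].
have x00 : 0 < x by rewrite lt_neqAle eq_sym xn0.
by move=> h; rewrite -(ler_pM2l x00); lra.
Qed.

Lemma measurable_density :
  measurable_fun [set: lebesgueTypeR R] (fun x => (f x)%:E).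
Proof.
have mD : measurable (D : set (measurableTypeR R)).
  by apply: open_measurable; exact: eitv_open.
have mf : measurable_fun [set: measurableTypeR R] f.
  rewrite (_ : f = f \_ D).
    apply/(measurable_restrictT f mD); apply: open_continuous_measurable_fun.
      exact: eitv_open.
    by move=> x; rewrite inE; exact: density_continuous.
  apply/funext => x; rewrite patchE.
  by case: ifPn => // /f_out.
move=> _ Y mY; have mfE : measurable_fun [set: measurableTypeR R] (fun x => (f x)%:E).
  exact/measurable_EFinP.
by apply: lebesgue_measurable_borel; exact: mfE.
Qed.

Lemma mu_null A : measurable A -> leb A = 0%E -> mu A = 0%E.
Proof.
move=> mA A0; rewrite (f_density mA).
exact: (null_set_integral mA (measurable_funTS measurable_density) A0).
Qed.

Lemma mu_le A (M : R) : measurable A -> (forall x, A x -> f x <= M) ->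
  (mu A <= M%:E * leb A)%E.
Proof.
move=> mA fM; rewrite (f_density mA) -(integral_cst _ mA).
apply: (ge0_le_integral _ mA).
- by move=> x _; rewrite lee_fin; exact: density_ge0.
- exact: measurable_funTS measurable_density.
- exact: measurable_cst.
- by move=> x Ax; rewrite lee_fin; exact: fM.
Qed.

Lemma mu_ge A (m : R) : measurable A -> 0 <= m -> (forall x, A x -> m <= f x) ->
  (m%:E * leb A <= mu A)%E.
Proof.
move=> mA m0 fm; rewrite (f_density mA) -(integral_cst _ mA).
apply: (ge0_le_integral _ mA).
- by move=> x _; rewrite lee_fin.
- exact: measurable_cst.
- exact: measurable_funTS measurable_density.
- by move=> x Ax; rewrite lee_fin; exact: fm.
Qed.

Lemma muI_setT_le x y (M : R) : x <= y -> (forall t, x < t -> t <= y -> f t <= M) ->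
  muI mu setT x y <= M * (y - x).
Proof.
move=> xy fM; rewrite -lee_fin muIE// setTI EFinM -(leb_itvE false false xy).
apply: mu_le; first exact: measurable_litv.
by move=> t /=; rewrite in_itv/= => /andP[]; exact: fM.
Qed.

Lemma muI_setT_ge x y (m : R) : x <= y -> (forall t, x < t -> t <= y -> m <= f t) ->
  m * (y - x) <= muI mu setT x y.
Proof.
move=> xy fm; have [m0|m0] := leP 0 m; last first.
  by rewrite (le_trans _ (muI_ge0 mu _ _ _))// mulr_le0_ge0 ?subr_ge0// ltW.
rewrite -lee_fin muIE// setTI EFinM -(leb_itvE false false xy).
apply: mu_ge => //; first exact: measurable_litv.
by move=> t /=; rewrite in_itv/= => /andP[]; exact: fm.
Qed.

Lemma muI_null E x y : measurable E -> lebI E x y = 0 -> muI mu E x y = 0.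
Proof.
move=> mE E0; apply/EFin_inj; rewrite muIE//; apply: mu_null.
  by apply: measurableI => //; exact: measurable_litv.
by rewrite -lebIE// E0.
Qed.

Lemma mu_set1 x : mu [set x] = 0%E.
Proof.
apply: mu_null; last exact: leb_set1.
by rewrite -set_itv1; exact: measurable_litv.
Qed.

Lemma support_nonempty : exists x, D x.
Proof.
apply: contrapT => /forallNP nD.
have := @probability_setT _ _ _ mu; rewrite f_density// integral0_eq.
  by move=> /esym/eqP; rewrite onee_eq0.
by move=> x _; rewrite f_out// notin_setE.
Qed.

Lemma support0 : D 0.
Proof.
have [x Dx] := support_nonempty.
have Dx' := density_support_opp Dx.
have [x0|x0] := leP 0 x.
  by apply: (eitv_between Dx' Dx) => //; lra.
by apply: (eitv_between Dx Dx') => //; lra.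
Qed.

(** A global bound on [f] makes [F] continuous at the ends of the support too,
    where [f] may jump. *)
Lemma cdf_lip x y : x <= y -> F y - F x <= f 0 * (y - x).
Proof.
move=> xy; rewrite -muI_setT//; apply: muI_setT_le => // t _ _.
by apply: density_le_max; exact: support0.
Qed.

Lemma cdf_lt x y : D x -> D y -> x < y -> F x < F y.
Proof.
move=> Dx Dy xy; rewrite -subr_gt0 -muI_setT ?ltW//.
have fx0 : 0 < f x by exact/density_gt0P.
have fy0 : 0 < f y by exact/density_gt0P.
have m0 : 0 < Num.min (f x) (f y) by rewrite lt_min fx0.
rewrite (@lt_le_trans _ _ (Num.min (f x) (f y) * (y - x)))//.
  by rewrite mulr_gt0// subr_gt0.
apply: muI_setT_ge; first exact: ltW.
move=> t xt ty; have Dt := eitv_between Dx Dy (ltW xt) ty.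
have ft0 : 0 < f t by exact/density_gt0P.
have := ln_density_concave Dx Dy (ltW xt) ty.
case: (leP (f x) (f y)) => fxy h.
  rewrite -ler_ln ?posrE//.
  have : ln (f x) <= ln (f y) by rewrite ler_ln ?posrE.
  have yx : 0 < y - x by lra.
  by move=> ?; rewrite -(ler_pM2l yx); nra.
rewrite -ler_ln ?posrE//.
have : ln (f y) <= ln (f x) by rewrite ler_ln ?posrE// ltW.
have yx : 0 < y - x by lra.
by move=> ?; rewrite -(ler_pM2l yx); nra.
Qed.

(** * Distribution function and isoperimetric profile *)

Lemma cdf_continuous : continuous F.
Proof.
have f00 : 0 < f 0 by apply/density_gt0P; exact: support0.
apply: (lipschitz_continuous f00) => x y xy.
by rewrite distrC ger0_norm ?subr_ge0 ?cdf_mono//; exact: cdf_lip.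
Qed.

Lemma is_derive_cdf y : D y -> is_derive y 1 F (f y).
Proof.
move=> Dy.
have lim : h^-1 *: ((F \o shift y) (h *: 1) - F y) @[h --> 0^'] --> f y.
  apply/cvgrPdist_le => e e0.
  have /cvgrPdist_le/(_ e e0)/nbhs_ballP[d /= d0 hd] := density_continuous Dy.
  near=> h.
  have hn0 : h != 0 by near: h; exact: nbhs_dnbhs_neq.
  have hltd : `|h| < d by near: h; exact: dnbhs0_lt.
  rewrite /= [_ *: _]mulrC [h *: 1]mulr1.
  have fnear t : `|t - y| <= `|h| -> f y - e <= f t /\ f t <= f y + e.
    move=> th; have := hd t; rewrite /ball/= distrC (le_lt_trans th)// => /(_ isT).
    by rewrite ler_norml => /andP[? ?]; split; lra.
  case: (ltgtP h 0) hn0 => // h0 _.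
    have yh : h + y <= y by lra.
    have l1 : muI mu setT (h + y) y <= (f y + e) * (y - (h + y)).
      apply: muI_setT_le => // t t1 t2; apply: (proj2 (fnear t _)).
      by rewrite !ler0_norm//; lra.
    have l2 : (f y - e) * (y - (h + y)) <= muI mu setT (h + y) y.
      apply: muI_setT_ge => // t t1 t2; apply: (proj1 (fnear t _)).
      by rewrite !ler0_norm//; lra.
    rewrite muI_setT// in l1 l2.
    have e1 : (F (h + y) - F y) / h * h = F (h + y) - F y.
      by rewrite divfK// lt_eqF.
    set q := _ / h in e1 *; clearbody q.
    rewrite ler_norml; apply/andP; split; rewrite -(ler_nM2l h0); nra.
  have yh : y <= h + y by lra.
  have l1 : muI mu setT y (h + y) <= (f y + e) * (h + y - y).
    apply: muI_setT_le => // t t1 t2; apply: (proj2 (fnear t _)).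
    by rewrite !ger0_norm//; lra.
  have l2 : (f y - e) * (h + y - y) <= muI mu setT y (h + y).
    apply: muI_setT_ge => // t t1 t2; apply: (proj1 (fnear t _)).
    by rewrite !ger0_norm//; lra.
  rewrite muI_setT// in l1 l2.
  have e1 : (F (h + y) - F y) / h * h = F (h + y) - F y.
    by rewrite divfK// gt_eqF.
  set q := _ / h in e1 *; clearbody q.
  rewrite ler_norml; apply/andP; split; rewrite -(ler_pM2l h0); nra.
by apply: DeriveDef; [exact: cvgP lim|exact: cvg_lim lim].
Unshelve. all: by end_near. Qed.

Lemma cdf_tail e : 0 < e -> exists2 x, 0 <= x & 1 - e < F x - F (- x).
Proof.
move=> e0.
pose A (n : nat) : set (lebesgueTypeR R) :=
  [set` `](- n%:R)%R, (n%:R : R)]].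
have mA n : measurable (A n) by exact: measurable_litv.
have bigA : \bigcup_n A n = setT.
  apply/seteqP; split=> // x _; exists (Num.bound `|x|) => //=.
  have := archi_boundP (normr_ge0 x); rewrite ltr_norml => /andP[x1 x2].
  by rewrite /A/= in_itv/= x1 ltW.
have ndA : {homo A : n m / (n <= m)%N >-> (n <= m)%O}.
  move=> n m nm; apply/subsetPset => x; rewrite /A/= !in_itv/= => /andP[h1 h2].
  have : n%:R <= m%:R :> R by rewrite ler_nat.
  by move=> h; apply/andP; split; lra.
have mbigA : measurable (\bigcup_n A n) by rewrite bigA.
have cvA : mu (A n) @[n --> \oo] --> mu (\bigcup_n A n).
  exact: nondecreasing_cvg_mu mA mbigA ndA.
have mu1 : mu (\bigcup_n A n) = 1%:E by rewrite bigA; exact: probability_setT.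
rewrite mu1 in cvA; have /fine_cvgP[_ /cvgrPdist_lt/(_ e e0)] := cvA.
move=> [n _ /(_ n (leqnn n))] /=.
have n0 : 0 <= n%:R :> R by [].
have AE : fine (mu (A n)) = F n%:R - F (- n%:R).
  by rewrite -muI_setT ?ge0_cp// /muI setTI.
rewrite AE ltr_norml => /andP[_ h]; exists n%:R => //.
by lra.
Qed.

Lemma cdf_out x : ~ D x -> F x = 0 \/ F x = 1.
Proof.
move=> nDx; have D0 := support0.
have null (i : interval R) : (forall t, t \in i -> ~ D t) -> mu [set` i] = 0%E.
  move=> iD; rewrite f_density; last exact: measurable_litv.
  rewrite integral0_eq// => t /iD nDt; rewrite f_out//.
  by rewrite notin_setE.
have [x0|x0] := leP x 0; [left|right].
  rewrite /cdfR null// => t; rewrite in_itv/= => tx Dt; apply: nDx.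
  exact: (eitv_between Dt D0).
rewrite /cdfR -setCitvr probability_setC; last exact: measurable_litv.
rewrite null ?sube0//= => t; rewrite in_itv/= andbT => tx Dt; apply: nDx.
by apply: (eitv_between D0 Dt); exact: ltW.
Qed.

Lemma cdf_surj p : 0 < p -> p < 1 -> exists2 x, D x & F x = p.
Proof.
move=> p0 p1.
have [x0 x00] : exists2 x, 0 <= x & 1 - Num.min p (1 - p) < F x - F (- x).
  by apply: cdf_tail; rewrite lt_min p0 subr_gt0.
have := cdf_ge0 mu (- x0); have := cdf_le1 mu x0.
have [hp|hp] := leP p (1 - p) => h1 h0 hm.
all: have [||x _ Fx] := @IVT R F (- x0) x0 p (ltac:(lra) : - x0 <= x0).
all: try (exact: continuous_subspaceT cdf_continuous).
all: try (by rewrite min_l ?max_r; lra).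
all: exists x => //; apply: contrapT => /cdf_out; lra.
Qed.

(** Differentiating [F t + F (- t)] gives the symmetry of [F] without a change of
    variable in the integral of [f]. *)
Lemma cdf_opp_cst x : D x -> 0 < x -> F x + F (- x) = F 0 + F 0.
Proof.
move=> Dx x0; pose k t := F t + F (- t).
have kd t : t \in `]0, x[ -> is_derive t 1 k 0.
  rewrite in_itv/= => /andP[t0 tx].
  have Dt : D t by apply: (eitv_between support0 Dx); exact: ltW.
  have d1 := is_derive_cdf Dt.
  have d2 := is_derive_cdf (density_support_opp Dt).
  have d3 : is_derive t 1 (fun t : R => F (- t)) (- f t).
    have := @is_derive1_comp R F -%R t (f (- t)) (-1) d2 _.
    rewrite f_sym mulrN1; apply.
  have := is_deriveD d1 d3; rewrite subrr; exact.
have kc : {within `[0, x], continuous k}.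
  apply: continuous_subspaceT => t; apply: cvgD; first exact: cdf_continuous.
  apply: (@continuous_comp _ _ _ -%R F); last exact: cdf_continuous.
  exact: opp_continuous.
have [c _] := MVT x0 kd kc.
by rewrite mul0r /k oppr0 => /eqP; rewrite subr_eq0 => /eqP.
Qed.

(** The constant value of [F t + F (- t)] is found by letting [F t] tend to 1. *)
Lemma cdf_opp x : D x -> F (- x) = 1 - F x.
Proof.
suff half : F 0 + F 0 = 1.
  have pos t : D t -> 0 < t -> F (- t) = 1 - F t.
    by move=> Dt t0; have := cdf_opp_cst Dt t0; lra.
  move=> Dx; case: (ltgtP 0 x) => [|x0|<-]; first exact: pos.
    by have := pos _ (density_support_opp Dx) ltac:(lra); rewrite opprK; lra.
  by rewrite oppr0; lra.
apply/eqP; rewrite eq_le; apply/andP; split; apply/ler_addgt0Pr => e e0.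
all: pose d := Num.min e (1 / 2) / 2.
all: have [d0 d1 de] : [/\ 0 < d, d < 1 / 2 & d <= e]
  by rewrite /d; case: (leP e (1 / 2)) => *; split; lra.
all: have [u Du Fu] := cdf_surj (ltac:(lra) : 0 < 1 - d) ltac:(lra).
all: have [v Dv Fv] := cdf_surj d0 ltac:(lra).
all: have Dw : D (Num.max u (- v))
  by case: (leP u (- v)) => _ //; exact: density_support_opp.
all: have uw : u <= Num.max u (- v) by rewrite le_max lexx.
all: have vw : - Num.max u (- v) <= v by rewrite lerNl le_max lexx orbT.
all: set w := Num.max u (- v) in Dw uw vw; clearbody w.
all: have Fw := cdf_mono mu uw; have Fw' := cdf_mono mu vw.
all: have w1 := cdf_le1 mu w; have w0 := cdf_ge0 mu (- w).
all: have wpos : 0 < w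
  by rewrite ltNge; apply/negP => w00;
     have := cdf_mono mu (ltac:(lra) : w <= - w); lra.
all: have := cdf_opp_cst Dw wpos; lra.
Qed.

(** On [y, u] the function [f t * expR (- (c * t))] lies between its value at [u]
    and its value at [y], which is the larger one.  Take for [kappa] the value at
    [u] if [0 <= c] and the value at [y] if [c < 0]: then the derivative of
    [c * F t - kappa * expR (c * t)] is nonnegative, and comparing this function
    at [y] and at [u] gives the claim. *)
Lemma density_le_right y u c : D y -> D u -> y < u ->
  (forall t, D t -> ln (f t) <= ln (f y) + c * (t - y)) ->
  f u <= f y + c * (F u - F y).
Proof.
move=> Dy Du yu hc.
have fE t : D t -> f t = expR (ln (f t)).
  by move=> Dt; rewrite lnK// posrE; apply/density_gt0P.
have Dyu t : y <= t -> t <= u -> D t by move=> yt tu; exact: (eitv_between Dy Du).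
have upper t : y <= t -> t <= u -> f t <= f y * expR (- (c * y)) * expR (c * t).
  move=> yt tu; have Dt := Dyu _ yt tu.
  rewrite (fE t)// (fE y)// -!expRD ler_expR; have := hc t Dt; lra.
have lower t : y <= t -> t <= u -> f u * expR (- (c * u)) * expR (c * t) <= f t.
  move=> yt tu; have Dt := Dyu _ yt tu.
  rewrite (fE t)// (fE u)// -!expRD ler_expR.
  have h1 := ln_density_concave Dy Du yt tu; have h2 := hc u Du.
  have uy0 : 0 < u - y by lra.
  rewrite -(ler_pM2l uy0).
  have : 0 <= (u - t) * (ln (f y) + c * (u - y) - ln (f u)) by rewrite mulr_ge0//; lra.
  nra.
pose k kappa t := c * F t - kappa * expR (c * t).
have kd kappa t : y < t -> t < u ->
    is_derive t 1 (k kappa) (c * (f t - kappa * expR (c * t))).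
  move=> yt tu; have Dt := Dyu _ (ltW yt) (ltW tu).
  have d1 := is_deriveZ c (is_derive_cdf Dt).
  have d2 : is_derive t 1 (fun t : R => expR (c * t)) (expR (c * t) * c).
    apply: (@is_derive1_comp _ expR ( *%R c) t (expR (c * t)) c).
    have := is_deriveZ c (is_derive_id t (1:R)); rewrite /GRing.scale/= mulr1; exact.
  apply: is_derive_eq (is_deriveB d1 (is_deriveZ kappa d2)) _.
  by rewrite /GRing.scale/=; ring.
have kc kappa : continuous (k kappa).
  move=> t; apply: cvgB.
    by apply: cvgMr; exact: cdf_continuous.
  apply: cvgMr; apply: (@continuous_comp _ _ _ ( *%R c) expR).
    by apply: cvgMr; exact: cvg_id.
  exact: continuous_expR.
have kmono kappa : (forall t, y < t -> t < u -> 0 <= c * (f t - kappa * expR (c * t))) ->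
    k kappa y <= k kappa u.
  move=> dk; apply: (@ger0_derive1_le_cc _ (k kappa) y u).
  - move=> t; rewrite in_itv/= => /andP[yt tu].
    exact: (@ex_derive _ _ _ _ _ _ _ (kd kappa t yt tu)).
  - move=> t; rewrite in_itv/= => /andP[yt tu]; rewrite derive1E.
    by rewrite (@derive_val _ _ _ _ _ _ _ (kd kappa t yt tu)); exact: dk.
  - exact: continuous_subspaceT (kc kappa).
  - by rewrite in_itv/= lexx ltW.
  - by rewrite in_itv/= lexx ltW.
  - exact: ltW.
have cancel t : f t * expR (- (c * t)) * expR (c * t) = f t.
  by rewrite -mulrA -expRD addrC subrr expR0 mulr1.
have [c0|c0] := leP 0 c.
  have := lower y (lexx y) (ltW yu).
  suff : k (f u * expR (- (c * u))) y <= k (f u * expR (- (c * u))) u.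
    by rewrite /k cancel; lra.
  apply: kmono => t yt tu; apply: mulr_ge0 => //.
  by rewrite subr_ge0 lower// ltW.
have := upper u (ltW yu) (lexx u).
suff : k (f y * expR (- (c * y))) y <= k (f y * expR (- (c * y))) u.
  by rewrite /k cancel; lra.
apply: kmono => t yt tu; apply: mulr_le0 => //; first exact: ltW.
by rewrite subr_le0 upper// ltW.
Qed.

(** Points on the left of [y] are reflected to the right of [- y], where [- c] is a
    supergradient. *)
Lemma density_supergradient y : D y -> exists c, forall u, D u ->
  f u <= f y + c * (F u - F y).
Proof.
move=> Dy; have [c hc] := ln_density_supergradient Dy; exists c => u Du.
case: (ltgtP u y) => [uy|yu|->]; last by rewrite subrr mulr0 addr0.
  have := @density_le_right (- y) (- u) (- c) (density_support_opp Dy)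
    (density_support_opp Du) ltac:(lra).
  rewrite !f_sym !cdf_opp// => h.
  have : f u <= f y + - c * (1 - F u - (1 - F y)).
    apply: h => t Dt; have := hc _ (density_support_opp Dt); rewrite f_sym; lra.
  lra.
exact: density_le_right.
Qed.

Definition quantile (p : R) : R := 'pinv_(fun=> 0) D F p.

Lemma quantileP p : 0 < p -> p < 1 -> D (quantile p) /\ F (quantile p) = p.
Proof.
move=> p0 p1; have surj : set_surj D `]0, 1[ F.
  move=> q /=; rewrite in_itv/= => /andP[q0 q1].
  by have [x Dx Fx] := cdf_surj q0 q1; exists x.
have p01 : p \in `]0, 1[%classic by rewrite inE/= in_itv/= p0.
split; last exact: (surjpK _ surj p01).
by apply: (surjpinv_image_sub surj); exists p => //; rewrite inE in p01.
Qed.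

Lemma quantile_cdf x : D x -> quantile (F x) = x.
Proof.
move=> Dx; apply: pinvKV; last by rewrite inE.
move=> s t; rewrite !inE => Ds Dt Fst.
case: (ltgtP s t) => // st.
  by have := cdf_lt Ds Dt st; rewrite Fst ltxx.
by have := cdf_lt Dt Ds st; rewrite Fst ltxx.
Qed.

Lemma cdf_in01 x : D x -> 0 < F x /\ F x < 1.
Proof.
move=> Dx; have [h h0 hD] := eitv_near Dx.
have Dp : D (x + h) by apply: hD; rewrite addrC addKr gtr0_norm.
have Dm : D (x - h) by apply: hD; rewrite addrC addKr normrN gtr0_norm.
split.
  by apply: (le_lt_trans (cdf_ge0 mu (x - h))); apply: cdf_lt => //; lra.
by apply: lt_le_trans (cdf_le1 mu (x + h)); apply: cdf_lt => //; lra.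
Qed.

(** The value 0 at 0 and 1 may lie below the limits of [f] at the ends of the
    support; lowering a concave function at the ends of its domain keeps it
    concave. *)
Definition isoprofile (p : R) : R := if 0 < p < 1 then f (quantile p) else 0.

Lemma isoprofile_cdf x : D x -> isoprofile (F x) = f x.
Proof.
by move=> Dx; have [F0 F1] := cdf_in01 Dx; rewrite /isoprofile F0 F1 quantile_cdf.
Qed.

Lemma isoprofile_ge0 p : 0 <= isoprofile p.
Proof. by rewrite /isoprofile; case: ifP => // _; exact: density_ge0. Qed.

Lemma isoprofile_sym p : isoprofile (1 - p) = isoprofile p.
Proof.
rewrite /isoprofile (_ : (0 < 1 - p < 1) = (0 < p < 1)); last first.
  by rewrite subr_gt0 ltrBlDr ltrDl andbC.
case: ifP => // /andP[p0 p1]; have [Dq Fq] := quantileP p0 p1.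
rewrite -{1}Fq -cdf_opp// quantile_cdf ?f_sym//; exact: density_support_opp.
Qed.

(** At the points 0 and 1 the inequality is the limit of the inequalities inside,
    whose left-hand sides are nonnegative. *)
Lemma isoprofile_supergradient y : 0 < y -> y < 1 ->
  exists c, forall x, 0 <= x -> x <= 1 -> isoprofile x <= isoprofile y + c * (x - y).
Proof.
move=> y0 y1; have [Dq Fq] := quantileP y0 y1.
have [c hc] := density_supergradient Dq; exists c => x x0 x1.
have inside t : 0 < t -> t < 1 -> isoprofile t <= isoprofile y + c * (t - y).
  move=> t0 t1; have [Dt Ft] := quantileP t0 t1.
  by rewrite /isoprofile t0 t1 y0 y1 /=; have := hc _ Dt; rewrite Ft Fq.
have [x00|x00] := ltP 0 x; have [x11|x11] := ltP x 1; first exact: inside.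
all: apply/ler_addgt0Pr => e e0.
all: have e1 : 0 < e / (`|c| + 1) by rewrite divr_gt0// ltr_wpDl.
all: have ecE : (`|c| + 1) * (e / (`|c| + 1)) = e
  by rewrite mulrCA divff ?mulr1// gt_eqF// ltr_wpDl.
all: have c1 := ler_norm c; have c2 := ler_norm (- c); rewrite normrN in c2.
all: set d0 := e / _ in e1 ecE; set n := `|c| in c1 c2 ecE; clearbody d0 n.
all: pose d := Num.min d0 (1 / 2).
all: have [d00 d01 dd] : [/\ 0 < d, d < 1 & d <= d0]
  by rewrite /d; case: (leP d0 (1 / 2)) => *; split; lra.
all: clearbody d.
- have -> : x = 1 by lra.
  have := inside (1 - d) ltac:(lra) ltac:(lra).
  have := isoprofile_ge0 (1 - d); rewrite [isoprofile 1]/isoprofile ltxx andbF => h1 h2.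
  have : n * d <= n * d0 by rewrite ler_wpM2l//; lra.
  have : - c * d <= n * d by rewrite ler_wpM2r// ltW.
  nra.
- have -> : x = 0 by lra.
  have := inside d ltac:(lra) ltac:(lra).
  have := isoprofile_ge0 d; rewrite [isoprofile 0]/isoprofile ltxx /= => h1 h2.
  have : n * d <= n * d0 by rewrite ler_wpM2l//; lra.
  have : c * d <= n * d by rewrite ler_wpM2r// ltW.
  nra.
- lra.
Qed.

Lemma isoprofile_iso : iso_profile isoprofile.
Proof.
split; first by rewrite /isoprofile ltxx.
  exact: isoprofile_sym.
move=> x y z x0 xy yz z1.
have y0 : 0 <= y by lra.
have y1 : y <= 1 by lra.
have [y00|y00] := leP y 0.
  have -> : y = x by lra.
  nra.
have [y11|y11] := leP 1 y.
  have -> : y = z by lra.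
  nra.
have [c hc] := isoprofile_supergradient y00 y11.
have hx := hc x x0 ltac:(lra); have hz := hc z ltac:(lra) z1.
have h1 : (z - y) * isoprofile x <= (z - y) * (isoprofile y + c * (x - y)).
  by rewrite ler_wpM2l//; lra.
have h2 : (y - x) * isoprofile z <= (y - x) * (isoprofile y + c * (z - y)).
  by rewrite ler_wpM2l//; lra.
lra.
Qed.

(** * Mass profile of a measurable set *)

Lemma cdfR_inv_in p : 0 < p -> p < 1 -> Q p = (quantile p)%:E.
Proof. by move=> p0 p1; rewrite /cdfR_inv gt_eqF// lt_eqF. Qed.

Lemma cdfR_inv0 : Q 0 = -oo%E.
Proof. by rewrite /cdfR_inv eqxx. Qed.

Lemma cdfR_inv1 : Q 1 = +oo%E.
Proof. by rewrite /cdfR_inv oner_eq0 eqxx. Qed.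

Lemma quantile_lt p q : 0 < p -> p < q -> q < 1 -> quantile p < quantile q.
Proof.
move=> p0 pq q1.
have [Dp Fp] := quantileP p0 (lt_trans pq q1).
have [Dq Fq] := quantileP (lt_trans p0 pq) q1.
by rewrite ltNge; apply/negP => /(cdf_mono mu); rewrite Fp Fq; lra.
Qed.

Lemma cdfR_inv_le p q : 0 <= p -> p <= q -> q <= 1 -> (Q p <= Q q)%E.
Proof.
move=> p0; rewrite le_eqVlt => /predU1P[->//|pq] q1.
move: p0; rewrite le_eqVlt => /predU1P[<-|p0]; first by rewrite cdfR_inv0 leNye.
move: q1; rewrite le_eqVlt => /predU1P[->|q1]; first by rewrite cdfR_inv1 leey.
rewrite !cdfR_inv_in ?lee_fin//; [|exact: (lt_trans p0)|exact: (lt_trans pq)].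
by rewrite ltW// quantile_lt.
Qed.

Definition below p : set (lebesgueTypeR R) := eitv -oo%E (Q p).
Definition above p : set (lebesgueTypeR R) := eitv (Q p) +oo%E.

Lemma measurable_eitv u v : measurable (eitv u v : set (lebesgueTypeR R)).
Proof.
by apply: lebesgue_measurable_borel; apply: open_measurable; exact: eitv_open.
Qed.

Lemma belowI p q : 0 <= p -> p <= 1 -> 0 <= q -> q <= 1 ->
  below p `&` below q = below (Num.min p q).
Proof.
suff h p' q' : 0 <= p' -> p' <= q' -> q' <= 1 -> below p' `&` below q' = below p'.
  move=> p0 p1 q0 q1; case: (leP p q) => [pq|/ltW qp]; first exact: h.
  by rewrite setIC; apply: h.
move=> p0 pq q1; apply/setIidPl => x /eitvP/andP[_ xp]; apply/eitvP.
by rewrite ltNyr (lt_le_trans xp)// cdfR_inv_le.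
Qed.

Definition mass_below (E : set (lebesgueTypeR R)) (p : R) : R := fine (mu (E `&` below p)).

Lemma mass_below_in E p : measurable E -> 0 < p -> p < 1 ->
  mass_below E p = cdfI mu E (quantile p).
Proof.
move=> mE p0 p1; rewrite /mass_below /below cdfR_inv_in// /cdfI; congr fine.
have eE : eitv -oo%E (quantile p)%:E = [set` `]-oo, quantile p[].
  by apply/seteqP; split=> x; rewrite /eitv/= !in_itv/= ?ltNyr ?lte_fin.
have eE' : [set` `]-oo, quantile p]] = [set` `]-oo, quantile p[] `|` [set quantile p].
  apply/seteqP; split=> x; rewrite /= !in_itv/= le_eqVlt.
    by move=> /predU1P[->|]; [right|left].
  by move=> [->|->]; rewrite ?eqxx ?orbT.
rewrite eE eE' setIUr; apply/eqP; rewrite eq_le; apply/andP.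
have mI : measurable (E `&` [set` `]-oo, quantile p[]).
  by apply: measurableI => //; exact: measurable_litv.
have m1 : measurable ([set quantile p] : set (lebesgueTypeR R)).
  by rewrite -set_itv1; exact: measurable_litv.
split.
  rewrite le_measure ?inE//; apply: measurableU => //; exact: measurableI.
rewrite (le_trans (measureU2 _ _ _))//; first exact: measurableI.
rewrite -[leRHS]adde0 leeD2l//.
by rewrite -(mu_set1 (quantile p)) le_measure ?inE//; exact: measurableI.
Qed.

Lemma mass_below0 E : mass_below E 0 = 0.
Proof.
rewrite /mass_below /below cdfR_inv0 (_ : eitv _ _ = set0) ?setI0 ?measure0//.
by apply/seteqP; split=> // x /eitvP/andP[_]; rewrite ltNge leNye.
Qed.

Lemma mass_below1 E : mass_below E 1 = fine (mu E).
Proof.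
rewrite /mass_below /below cdfR_inv1 (_ : eitv _ _ = setT) ?setIT//.
by apply/seteqP; split=> // x _; apply/eitvP; rewrite ltNyr ltry.
Qed.

Lemma mass_below_setT p : 0 <= p -> p <= 1 -> mass_below setT p = p.
Proof.
rewrite le_eqVlt => /predU1P[<- _|p0]; first exact: mass_below0.
rewrite le_eqVlt => /predU1P[->|p1]; first by rewrite mass_below1 probability_setT.
by rewrite mass_below_in// cdfI_setT; have [] := quantileP p0 p1.
Qed.

Lemma mass_below_split E p q : measurable E -> 0 <= p -> p <= q -> q <= 1 ->
  mass_below E q = mass_below E p + fine (mu (E `&` (below q `\` below p))).
Proof.
move=> mE p0 pq q1.
have mp := measurable_eitv -oo%E (Q p); have mq := measurable_eitv -oo%E (Q q).
apply/EFin_inj; rewrite EFinD !fineK; [|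
  by apply: mu_fin; apply: measurableI => //; try exact: measurableD..].
rewrite -measureU; [|exact: measurableI|by apply: measurableI => //; exact: measurableD|].
  rewrite -setIUr setUDr setDv setD0; congr (mu (_ `&` _)).
  apply/esym/setUidPr => x /eitvP/andP[_ xp]; apply/eitvP.
  by rewrite ltNyr (lt_le_trans xp)// cdfR_inv_le.
by apply/seteqP; split => // x [[_ xp] [_ [_ /(_ xp)]]].
Qed.

Lemma mass_below_mono E p q : measurable E -> 0 <= p -> p <= q -> q <= 1 ->
  mass_below E p <= mass_below E q.
Proof.
by move=> mE p0 pq q1; rewrite (mass_below_split mE p0 pq q1) lerDl fine_ge0// measure_ge0.
Qed.

Lemma mass_below_lip E p q : measurable E -> 0 <= p -> p <= q -> q <= 1 ->
  mass_below E q - mass_below E p <= q - p.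
Proof.
move=> mE p0 pq q1; rewrite (mass_below_split mE p0 pq q1).
have := mass_below_split measurableT p0 pq q1.
rewrite !mass_below_setT//; try lra.
rewrite setTI => qE.
have mD : measurable (below q `\` below p) by apply: measurableD; exact: measurable_eitv.
suff : fine (mu (E `&` (below q `\` below p))) <= fine (mu (below q `\` below p)) by lra.
apply: fine_le; [by apply: mu_fin; exact: measurableI|exact: mu_fin|].
by apply: le_measure; rewrite ?inE//; exact: measurableI.
Qed.

Definition crossings (E : set (lebesgueTypeR R)) : set R :=
  F @` (ess_boundary E `&` D).

Lemma mass_below_pure E p q : measurable E -> 0 < p -> p < q -> q < 1 ->
  (forall z, crossings E z -> p < z -> z < q -> False) ->
  mass_below E q = mass_below E p \/ mass_below E q - mass_below E p = q - p.
Proof.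
move=> mE p0 pq q1 nS.
have [Dp Fp] := quantileP p0 (lt_trans pq q1).
have [Dq Fq] := quantileP (lt_trans p0 pq) q1.
have qpq := quantile_lt p0 pq q1.
rewrite !mass_below_in//; try lra.
rewrite (cdfI_split mu mE (ltW qpq)).
have [L0|L0] := eqVneq (lebI E (quantile p) (quantile q)) 0.
  by left; have := muI_null mE L0; lra.
have [L1|L1] := eqVneq (lebI E (quantile p) (quantile q)) (quantile q - quantile p).
  right; have := muI_compl mu (quantile p) (quantile q) mE.
  have L1' : lebI (~` E) (quantile p) (quantile q) = 0.
    by have := lebI_compl mE (ltW qpq); lra.
  have := muI_null (measurableC mE) L1'; have := muI_setT mu (ltW qpq).
  by rewrite Fp Fq; lra.
exfalso; have [||z [pz zq Ez]] := ess_boundary_between mE qpq.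
- by rewrite lt_neqAle eq_sym L0 lebI_ge0.
- by rewrite lt_neqAle L1 lebI_le// ltW.
have Dz := eitv_between Dp Dq (ltW pz) (ltW zq).
apply: (nS (F z)).
- by exists z.
- by rewrite -Fp; exact: cdf_lt.
- by rewrite -Fq; exact: cdf_lt.
Qed.

Lemma perimeter_ge E (xs : seq R) : uniq xs -> (forall x, x \in xs -> crossings E x) ->
  ((\sum_(x <- xs) isoprofile x)%:E <= perimeter f E)%E.
Proof.
move=> uxs xsE.
have qK x : x \in xs -> [/\ ess_boundary E (quantile x), D (quantile x) & F (quantile x) = x].
  by move=> /xsE[t [Et Dt] <-]; rewrite quantile_cdf.
pose ys := [seq quantile x | x <- xs].
have uys : uniq ys.
  rewrite map_inj_in_uniq// => x y /qK[_ _ {2}<-] /qK[_ _ {2}<-] ->//.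
apply: esum_ge; exists [set` ys].
  split; first exact: finite_seq.
  by move=> _ /= /mapP[x /qK[? ? ?] ->].
rewrite -fsbig_seq// /ys big_map -sumEFin big_seq [leRHS]big_seq.
apply: lee_sum => x /qK[_ Dx {1}<-].
by rewrite isoprofile_cdf.
Qed.

(** For [d <= x <= 1 - d] a crossing [x] contributes at least [isoprofile d > 0]
    to the perimeter, so that there are finitely many of them. *)
Lemma crossings_isolated E p : (perimeter f E < +oo)%E -> 0 < p -> p < 1 ->
  exists2 e : R, 0 < e & forall y, crossings E y -> y <> p -> e <= `|y - p|.
Proof.
move=> Pfin p0 p1.
pose d := Num.min p (1 - p) / 2.
have [d0 dp d1] : [/\ 0 < d, d + d <= p & d + d <= 1 - p].
  by rewrite /d; case: (leP p (1 - p)) => *; split; lra.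
have m0 : 0 < isoprofile d.
  have [Dd _] := quantileP d0 ltac:(lra).
  rewrite /isoprofile d0 (_ : d < 1)/=; last lra.
  exact/density_gt0P.
pose T := [set x | crossings E x /\ d <= x <= 1 - d].
have finT : finite_set T.
  apply: contrapT => infT.
  have Preal : perimeter f E = (fine (perimeter f E))%:E.
    rewrite fineK// ge0_fin_numE// esum_ge0// => x _.
    by rewrite lee_fin density_ge0.
  pose n := Num.bound (fine (perimeter f E) / isoprofile d).
  have [B BT nB] := infinite_set_fset n infT.
  have := perimeter_ge (finmap.fset_uniq B) (fun x xB => (BT x xB).1).
  rewrite Preal lee_fin leNgt => /negP; apply.
  apply: (@lt_le_trans _ _ (n%:R * isoprofile d)).
    rewrite -ltr_pdivrMr//; apply: archi_boundP.
    rewrite divr_ge0// ?isoprofile_ge0// fine_ge0// esum_ge0// => x _.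
    by rewrite lee_fin density_ge0.
  apply: (@le_trans _ _ (\sum_(x <- finmap.enum_fset B) isoprofile d)).
    rewrite big_const_seq count_predT iter_addr addr0 -[leRHS]mulr_natl ler_wpM2r ?isoprofile_ge0// ler_nat//.
  rewrite big_seq [leRHS]big_seq; apply: ler_sum => x xB.
  have [_ /andP[dx x1]] := BT x xB.
  exact: (iso_deeper isoprofile_iso (ltW d0) dx x1).
have cT : closed (T `\ p).
  have := accessible_finite_set_closed.1 (hausdorff_accessible (@Rhausdorff R)).
  by apply; exact: finite_setD.
have pT : (~` (T `\ p)) p by move=> [_]; apply.
have /nbhs_ballP[e /= e0 he] := open_nbhs_nbhs (conj (closed_openC cT) pT).
exists (Num.min e d); first by rewrite lt_min e0.
move=> y Sy yp; rewrite leNgt lt_min; apply/negP => /andP[ye yd].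
apply: (he y); first by rewrite /ball/= distrC.
split=> //; split=> //; move: yd; rewrite ltr_norml => /andP[? ?].
by apply/andP; split; lra.
Qed.

Lemma mass_below_profile E : measurable E -> (perimeter f E < +oo)%E ->
  mass_profile (mass_below E) (crossings E).
Proof.
move=> mE Pfin; split.
- exact: mass_below0.
- by move=> x y; exact: mass_below_mono mE.
- by move=> x y; exact: mass_below_lip mE.
- by move=> x y; exact: mass_below_pure mE.
- by move=> x; exact: crossings_isolated Pfin.
Qed.

(** Infinite perimeters satisfy every lower bound, and they are the only ones for
    which the crossings could accumulate. *)
Lemma perimeter_ge_cost E (T : R) : measurable E ->
  (mass_profile (mass_below E) (crossings E) -> cost_ge isoprofile (crossings E) T) ->
  (T%:E <= perimeter f E)%E.
Proof.
move=> mE h; have [Pfin|] := ltP (perimeter f E) +oo%E; last first.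
  by rewrite leye_eq => /eqP ->; rewrite leey.
have [xs [uxs xsE Txs]] := h (mass_below_profile mE Pfin).
by apply: le_trans (perimeter_ge uxs xsE); rewrite lee_fin.
Qed.

(** * Asymmetry, intervals and pairs of half-lines *)

Lemma mu_above E p : measurable E -> 0 <= p -> p <= 1 ->
  fine (mu (E `&` above p)) = fine (mu E) - mass_below E p.
Proof.
move=> mE; rewrite le_eqVlt => /predU1P[<- _|p0].
  rewrite mass_below0 subr0 /above cdfR_inv0 (_ : eitv _ _ = setT) ?setIT//.
  by apply/seteqP; split=> // x _; apply/eitvP; rewrite ltNyr ltry.
rewrite le_eqVlt => /predU1P[->|p1].
  rewrite mass_below1 subrr /above cdfR_inv1 (_ : eitv _ _ = set0) ?setI0 ?measure0//.
  by apply/seteqP; split=> // x /eitvP/andP[]; rewrite ltNge leey.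
rewrite mass_below_in// /cdfI /above cdfR_inv_in//.
have mI (i : interval R) : measurable (E `&` [set` i]).
  by apply: measurableI => //; exact: measurable_litv.
have -> : eitv (quantile p)%:E +oo%E = [set` `]quantile p, +oo[].
  by apply/seteqP; split=> x; rewrite /eitv/= !in_itv/= ?ltry ?lte_fin ?andbT.
have muE : (mu E = mu (E `&` [set` `]-oo, quantile p]]) + mu (E `&` [set` `]quantile p, +oo[]))%E.
  rewrite -measureU//.
    by rewrite -setIUr -setCitvr setvU setIT.
  by rewrite setIACA -setCitvr setICl setI0.
have := congr1 fine muE; rewrite fineD ?mu_fin//; lra.
Qed.

Lemma mu_symdiff A E : measurable A -> measurable E ->
  fine (mu (A `+` E)) = fine (mu A) + fine (mu E) - 2 * fine (mu (A `&` E)).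
Proof.
move=> mA mE; rewrite measureU; [|exact: measurableD|exact: measurableD|]; last first.
  by apply/seteqP; split=> // x [[_ nEx] [Ex _]].
rewrite !measureD ?ltey_eq ?mu_fin// (setIC E A).
have mAE : measurable (A `&` E) by exact: measurableI.
have finB X : measurable X -> (mu X - mu (A `&` E))%E \is a fin_num.
  by move=> mX; rewrite fin_numB !mu_fin.
rewrite fineD ?finB// !fineB ?mu_fin//; lra.
Qed.

Lemma mu_below p : 0 <= p -> p <= 1 -> fine (mu (below p)) = p.
Proof. by move=> p0 p1; rewrite -[below p]setTI; exact: mass_below_setT. Qed.

(** Both half-lines in the definition have the mass of [E]; the right one is the
    complement of [below (1 - r)] up to a null set. *)
Lemma asymmetryE E : measurable E ->
  asymmetry mu a b E = (mass_asymmetry (mass_below E))%:E.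
Proof.
move=> mE; rewrite /asymmetry /mass_asymmetry mass_below1.
have r0 : 0 <= fine (mu E) by rewrite fine_ge0// measure_ge0.
have r1 : fine (mu E) <= 1.
  by rewrite -lee_fin fineK ?mu_fin// probability_le1.
set r := fine (mu E) in r0 r1 *.
have mX u v : measurable (E `+` eitv u v).
  by apply: measurableU; apply: measurableD => //; exact: measurable_eitv.
rewrite -[mu (E `+` eitv -oo%E _)]fineK ?mu_fin//.
rewrite -[mu (E `+` eitv _ +oo%E)]fineK ?mu_fin// -EFin_min; congr (_%:E).
rewrite !mu_symdiff//; try exact: measurable_eitv.
rewrite -/(below r) -/(above (1 - r)) -/(mass_below E r) mu_below//.
rewrite mu_above//; [|lra|lra].
have -> : fine (mu (above (1 - r))) = r.
  rewrite -[above _]setTI mu_above//; [|lra|lra].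
  by rewrite mass_below_setT ?probability_setT /=; lra.
by congr Num.min; rewrite -/r; lra.
Qed.

Lemma mass_below_interval u v p : 0 <= u -> u <= 1 -> 0 <= v -> v <= 1 ->
  0 <= p -> p <= 1 ->
  mass_below (eitv (Q u) (Q v)) p = Num.min v p - Num.min (Num.min v p) u.
Proof.
move=> u0 u1 v0 v1 p0 p1; have m0 : 0 <= Num.min v p by rewrite le_min v0.
have m1 : Num.min v p <= 1 by rewrite ge_min v1.
have eE : eitv (Q u) (Q v) = below v `&` above u.
  apply/seteqP; split=> x.
    by move=> /eitvP/andP[ux xv]; split; apply/eitvP; rewrite ?ux ?xv ?ltNyr ?ltry.
  by move=> [/eitvP/andP[_ xv] /eitvP/andP[ux _]]; apply/eitvP; rewrite ux.
rewrite /mass_below eE setIAC belowI// mu_above//; last exact: measurable_eitv.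
rewrite mu_below// /mass_below belowI// mu_below//; first by rewrite le_min m0.
by rewrite ge_min m1.
Qed.

Lemma mass_below_tails u v p : 0 <= u -> u <= v -> v <= 1 -> 0 <= p -> p <= 1 ->
  mass_below (below u `|` above v) p = Num.min u p + (p - Num.min p v).
Proof.
move=> u0 uv v1 p0 p1; have [v0 u1] : 0 <= v /\ u <= 1 by lra.
rewrite /mass_below setIUl measureU; first last.
- apply/seteqP; split=> // x [[/eitvP/andP[_ xu] _] [/eitvP/andP[vx _] _]].
  by have := lt_le_trans (lt_trans vx xu) (cdfR_inv_le u0 uv v1); rewrite ltxx.
- by apply: measurableI; exact: measurable_eitv.
- by apply: measurableI; exact: measurable_eitv.
rewrite fineD; [|by apply: mu_fin; apply: measurableI; exact: measurable_eitv..].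
rewrite belowI// mu_below; [|by rewrite le_min u0|by rewrite ge_min u1].
rewrite setIC mu_above//; last exact: measurable_eitv.
rewrite mu_below// /mass_below belowI// mu_below//; first by rewrite le_min p0.
by rewrite ge_min p1.
Qed.

(** Points of [A] have density 1 and points of [B] density 0. *)
Lemma ess_boundary_sub (A B X : set R) : open A -> open B -> A `&` B = set0 ->
  (forall x, ~ X x -> A x \/ B x) -> ess_boundary A `<=` X.
Proof.
move=> oA oB AB0 ABX x /not_orP[n0 n1]; apply: contrapT => /ABX.
have leb_ball1 (rho : R) : 0 < rho -> leb (ball x rho) = (rho + rho)%:E.
  move=> r0; rewrite ball_itv leb_itvE; last by lra.
  by congr EFin; lra.
case=> [Ax|Bx]; [apply: n1|apply: n0]; apply: cvg_near_cst.
  have /nbhs_ballP[e /= e0 he] := open_nbhs_nbhs (conj oA Ax).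
  near=> rho; have r0 : 0 < rho by near: rho; exact: nbhs_right_gt.
  have re : rho < e by near: rho; exact: nbhs_right_lt.
  rewrite (_ : A `&` ball x rho = ball x rho); last first.
    by apply/setIidr => t /(le_ball (ltW re)); exact: he.
  rewrite leb_ball1// inver gt_eqF ?addr_gt0// -EFinM mulfV// gt_eqF ?addr_gt0//.
have /nbhs_ballP[e /= e0 he] := open_nbhs_nbhs (conj oB Bx).
near=> rho; have re : rho < e by near: rho; exact: nbhs_right_lt.
rewrite (_ : A `&` ball x rho = set0) ?measure0 ?mul0e//.
apply/seteqP; split=> // t [At /(le_ball (ltW re))/he Bt].
by rewrite -AB0.
Unshelve. all: by end_near. Qed.

Lemma perimeter_le2 (A : set R) x y : x != y ->
  ess_boundary A `<=` [set x; y] -> (perimeter f A <= (f x + f y)%:E)%E.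
Proof.
move=> xy Axy; rewrite /perimeter esum_mkcond.
apply: (@le_trans _ _ (\esum_(t in [set` [:: x; y]]) (f t)%:E)%E).
  rewrite [leRHS]esum_mkcond; apply: le_esum => t _.
  case: ifPn => [|_].
    rewrite inE => /Axy txy; rewrite ifT// inE /= !inE.
    by case: txy => ->; rewrite eqxx ?orbT.
  by case: ifP => // _; rewrite lee_fin density_ge0.
rewrite esum_fset; [|exact: finite_seq|by move=> t _; rewrite lee_fin density_ge0].
by rewrite -fsbig_seq/= ?inE ?xy// !big_cons big_nil adde0 EFinD.
Qed.

Lemma isoprofileE p : 0 < p -> p < 1 -> f (quantile p) = isoprofile p.
Proof. by move=> p0 p1; rewrite /isoprofile p0 p1. Qed.

(** * Minimizers *)

Local Notation minimizer := (perimeter_minimizer mu f a b).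

Lemma minimizer_intro A r lam T : measurable A -> mass_below A 1 = r ->
  mass_asymmetry (mass_below A) = lam -> (perimeter f A <= T%:E)%E ->
  (forall G S, mass_profile G S -> G 1 = r -> mass_asymmetry G = lam ->
     cost_ge isoprofile S T) ->
  minimizer r lam A.
Proof.
move=> mA A1 Alam AT hT; split.
  split=> //; last by rewrite asymmetryE// Alam.
  by rewrite -A1 mass_below1 fineK// mu_fin.
move=> B [mB Br Blam]; apply: (le_trans AT); apply: perimeter_ge_cost => // dB.
apply: hT dB _ _; first by rewrite mass_below1 Br.
by move: Blam; rewrite asymmetryE// => -[].
Qed.

Lemma interval_tails_cover u v x : 0 < u -> u < v -> v < 1 ->
  ~ [set quantile u; quantile v] x ->
  eitv (Q u) (Q v) x \/ (below u `|` above v) x.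
Proof.
move=> u0 uv v1; have v0 := lt_trans u0 uv; have u1 := lt_trans uv v1.
rewrite /below/above !cdfR_inv_in// => nx.
case: (ltgtP x (quantile u)) => [xu|ux|xu]; last by case: nx; left.
  by right; left; apply/eitvP; rewrite ltNyr lte_fin.
case: (ltgtP x (quantile v)) => [xv|vx|xv]; last by case: nx; right.
  by left; apply/eitvP; rewrite !lte_fin ux.
by right; right; apply/eitvP; rewrite ltry lte_fin vx.
Qed.

Lemma interval_tails_disj u v : 0 < u -> u < v -> v < 1 ->
  eitv (Q u) (Q v) `&` (below u `|` above v) = set0.
Proof.
move=> u0 uv v1; apply/seteqP; split=> // x [/eitvP/andP[ux xv]].
case=> /eitvP/andP[h1 h2].
  by have := lt_trans ux h2; rewrite ltxx.
by have := lt_trans xv h1; rewrite ltxx.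
Qed.

Lemma open_tails u v : open (below u `|` above v).
Proof. by apply: openU; exact: eitv_open. Qed.

Lemma perimeter_interval u v : 0 < u -> u < v -> v < 1 ->
  (perimeter f (eitv (Q u) (Q v)) <= (isoprofile u + isoprofile v)%:E)%E.
Proof.
move=> u0 uv v1; have v0 := lt_trans u0 uv; have u1 := lt_trans uv v1.
rewrite -!isoprofileE//; apply: perimeter_le2; first by rewrite lt_eqF// quantile_lt.
apply: (ess_boundary_sub (B := below u `|` above v)).
- exact: eitv_open.
- exact: open_tails.
- exact: interval_tails_disj.
- by move=> x; exact: interval_tails_cover.
Qed.

Lemma perimeter_tails u v : 0 < u -> u < v -> v < 1 ->
  (perimeter f (below u `|` above v) <= (isoprofile u + isoprofile v)%:E)%E.
Proof.
move=> u0 uv v1; have v0 := lt_trans u0 uv; have u1 := lt_trans uv v1.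
rewrite -!isoprofileE//; apply: perimeter_le2; first by rewrite lt_eqF// quantile_lt.
apply: (ess_boundary_sub (B := eitv (Q u) (Q v))).
- exact: open_tails.
- exact: eitv_open.
- by rewrite setIC; exact: interval_tails_disj.
- by move=> x /(interval_tails_cover u0 uv v1)[]; [right|left].
Qed.

Lemma mass_below_interval1 u v : 0 < u -> u < v -> v < 1 ->
  mass_below (eitv (Q u) (Q v)) 1 = v - u.
Proof.
move=> u0 uv v1; rewrite mass_below_interval; try lra.
by rewrite (min_l (ltW v1)) (min_r (ltW uv)).
Qed.

Lemma mass_below_tails1 u v : 0 < u -> u < v -> v < 1 ->
  mass_below (below u `|` above v) 1 = u + (1 - v).
Proof.
move=> u0 uv v1; rewrite mass_below_tails; try lra.
by rewrite (min_r (ltW v1)) min_l; lra.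
Qed.

Lemma mass_asymmetry_interval u v lam : 0 < u -> u < v -> v < 1 ->
  Num.min
    (2 * (v - u - (Num.min v (v - u) - Num.min (Num.min v (v - u)) u)))
    (2 * (Num.min v (1 - (v - u)) - Num.min (Num.min v (1 - (v - u))) u)) = lam ->
  mass_asymmetry (mass_below (eitv (Q u) (Q v))) = lam.
Proof.
move=> u0 uv v1 <-; rewrite /mass_asymmetry mass_below_interval1//.
by rewrite !mass_below_interval; try lra.
Qed.

Lemma mass_asymmetry_tails u v lam : 0 < u -> u < v -> v < 1 ->
  let r := u + (1 - v) in
  Num.min
    (2 * (r - (Num.min u r + (r - Num.min r v))))
    (2 * (Num.min u (1 - r) + (1 - r - Num.min (1 - r) v))) = lam ->
  mass_asymmetry (mass_below (below u `|` above v)) = lam.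
Proof.
move=> u0 uv v1 r <-; rewrite /mass_asymmetry mass_below_tails1//.
by rewrite !mass_below_tails /r; try lra.
Qed.

Lemma interval_minimizer_small r lam : 0 < r -> r <= 1 / 2 -> r < lam ->
  lam <= 2 * r -> lam <= 1 - r ->
  minimizer r lam (eitv (Q (lam / 2)) (Q (r + lam / 2))).
Proof.
move=> r0 r2 rl l2r l1r.
have [u0 uv v1] : [/\ 0 < lam / 2, lam / 2 < r + lam / 2 & r + lam / 2 < 1] by split; lra.
apply: (minimizer_intro (measurable_eitv _ _) _ _ (perimeter_interval u0 uv v1)).
- by rewrite mass_below_interval1//; lra.
- apply: mass_asymmetry_interval => //.
  rewrite (_ : r + lam / 2 - lam / 2 = r); last lra.
  rewrite (@min_r _ _ (r + lam / 2) r); last lra.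
  rewrite (@min_r _ _ r (lam / 2)); last lra.
  rewrite (@min_r _ _ (Num.min _ _) (lam / 2)); last by rewrite le_min; apply/andP; split; lra.
  case: (leP (r + lam / 2) (1 - r)) => h; rewrite ?min_l; lra.
- by move=> G S H G1 Glam; exact: (interval_cost isoprofile_iso H G1 Glam).
Qed.

Lemma tails_minimizer_small r lam : 0 < lam -> lam <= r -> r <= 1 / 2 ->
  minimizer r lam (below (r - lam / 2) `|` above (1 - lam / 2)).
Proof.
move=> l0 lr r2.
have [u0 uv v1] : [/\ 0 < r - lam / 2, r - lam / 2 < 1 - lam / 2 & 1 - lam / 2 < 1] by split; lra.
apply: (minimizer_intro _ _ _ (perimeter_tails u0 uv v1)).
- by apply: measurableU; exact: measurable_eitv.
- by rewrite mass_below_tails1//; lra.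
- apply: mass_asymmetry_tails => //.
  rewrite (_ : r - lam / 2 + _ = r); last lra.
  rewrite (@min_l _ _ (r - lam / 2) r); last lra.
  rewrite (@min_l _ _ (r - lam / 2) (1 - r)); last lra.
  rewrite (@min_l _ _ r (1 - lam / 2)); last lra.
  rewrite (@min_l _ _ (1 - r) (1 - lam / 2)); last lra.
  by rewrite min_l; lra.
- by move=> G S H G1 Glam; exact: (tails_cost isoprofile_iso H G1 Glam).
Qed.

(** The lower bound is that of [tails_minimizer_small] for the complements, whose
    mass is [1 - r]. *)
Lemma interval_minimizer_large r lam : 0 < lam -> lam <= 1 - r -> 1 / 2 <= r ->
  minimizer r lam (eitv (Q (1 - r - lam / 2)) (Q (1 - lam / 2))).
Proof.
move=> l0 lr r2.
have [u0 uv v1] : [/\ 0 < 1 - r - lam / 2, 1 - r - lam / 2 < 1 - lam / 2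
  & 1 - lam / 2 < 1] by split; lra.
apply: (minimizer_intro (measurable_eitv _ _) _ _ (perimeter_interval u0 uv v1)).
- by rewrite mass_below_interval1//; lra.
- apply: mass_asymmetry_interval => //.
  rewrite (_ : 1 - lam / 2 - (1 - r - lam / 2) = r); last lra.
  rewrite (@min_r _ _ (1 - lam / 2) r); last lra.
  rewrite (@min_r _ _ r (1 - r - lam / 2)); last lra.
  rewrite (@min_r _ _ (1 - lam / 2) (1 - r)); last lra.
  rewrite (@min_r _ _ (1 - r) (1 - r - lam / 2)); last lra.
  by rewrite min_r; lra.
- move=> G S H G1 Glam; apply: (tails_cost isoprofile_iso (mass_profile_compl H)) => //.
  + by rewrite G1.
  + by rewrite mass_asymmetry_compl.
  + lra.
Qed.

(** The lower bound is that of [interval_minimizer_small] for the complements,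
    whose mass is [1 - r]. *)
Lemma tails_minimizer_large r lam : 1 / 2 <= r -> r < 1 -> 1 - r < lam ->
  lam <= 2 * (1 - r) -> lam <= r ->
  minimizer r lam (below (lam / 2) `|` above (1 - r + lam / 2)).
Proof.
move=> r2 r1 rl l2r lr.
have [u0 uv v1] : [/\ 0 < lam / 2, lam / 2 < 1 - r + lam / 2
  & 1 - r + lam / 2 < 1] by split; lra.
apply: (minimizer_intro _ _ _ (perimeter_tails u0 uv v1)).
- by apply: measurableU; exact: measurable_eitv.
- by rewrite mass_below_tails1//; lra.
- apply: mass_asymmetry_tails => //.
  rewrite (_ : lam / 2 + _ = r); last lra.
  rewrite (@min_l _ _ (lam / 2) r); last lra.
  rewrite (@min_l _ _ (lam / 2) (1 - r)); last lra.
  rewrite (@min_l _ _ (1 - r) (1 - r + lam / 2)); last lra.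
  by case: (leP r (1 - r + lam / 2)) => h; rewrite min_r; lra.
- move=> G S H G1 Glam; apply: (interval_cost isoprofile_iso (mass_profile_compl H)).
  + by rewrite G1.
  + by rewrite mass_asymmetry_compl.
  + lra.
  + lra.
  + lra.
  + lra.
Qed.
End LogConcaveMeasure.

Theorem proposition2p7 (R : realType) (mu : probability (lebesgueTypeR R) R)
    (f : R -> R) (a b : \bar R)
    (f_density : is_density mu f)
    (f_pos : forall x, x \in eitv a b -> 0 < f x)
    (f_out : forall x, x \notin eitv a b -> f x = 0)
    (f_logconcave : log_concave f a b)
    (f_sym : forall x, f (- x) = f x)
    (r lam : R) :
  let Finv := cdfR_inv mu a b in
  let minimizer := perimeter_minimizer mu f a b r lam in
  [/\ 0 < r <= 1 / 2 -> r < lam <= Num.min (2 * r) (1 - r) ->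
        minimizer (eitv (Finv (lam / 2)) (Finv (r + lam / 2))),
      0 < lam <= r -> r <= 1 / 2 ->
        minimizer (eitv -oo%E (Finv (r - lam / 2)) `|`
                   eitv (Finv (1 - lam / 2)) +oo%E),
      0 < lam <= 1 - r -> 1 / 2 <= r < 1 ->
        minimizer (eitv (Finv (1 - r - lam / 2)) (Finv (1 - lam / 2))) &
      1 / 2 <= r < 1 -> 1 - r < lam <= Num.min (2 * (1 - r)) r ->
        minimizer (eitv -oo%E (Finv (lam / 2)) `|`
                   eitv (Finv (1 - r + lam / 2)) +oo%E)].
Proof.
move=> Finv minimizer; split.
- move=> /andP[r0 r2] /andP[rl]; rewrite le_min => /andP[l2 l1].
  exact: interval_minimizer_small.
- move=> /andP[l0 lr] r2; exact: tails_minimizer_small.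
- move=> /andP[l0 lr] /andP[r2 r1]; exact: interval_minimizer_large.
- move=> /andP[r2 r1] /andP[rl]; rewrite le_min => /andP[l2 l1].
  exact: tails_minimizer_large.
Qed.
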